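(* Let $X\in\mathfrak{X}^1(\mathbb{S}^6)$ be a vector field. (i) If $\mathcal{L}_XJ=0$, then $[X,JX]=0$. (ii) If $[X,JX]=0$, then $D\subset T\mathbb{S}^6$, defined by $D_p=\mathrm{span}_{\mathbb{R}}(X_p,J_p(X_p))$ for $p\in\mathbb{S}^6$, is a singular $J$-holomorphic foliation of $\mathbb{S}^6$ whose leaves are images of solutions of the dynamical Hamilton-de Donder-Weyl equation (with respect to a constant Hamiltonian function $H$ and the standard co-volume $\frac{\partial}{\partial t^1}\wedge\frac{\partial}{\partial t^2}$ on $\mathbb{R}^2$); namely, for all $p\in\mathbb{S}^6$, the leaf through $p$ is the image of the solution $$\psi_p^{X,JX}:\mathbb{R}^2\to\mathbb{S}^6,\quad\psi_p^{X,JX}(t^1,t^2)=\varphi^{JX}_{t^2}\circ\varphi^X_{t^1}(p),$$ where $\varphi^Z_t$ denotes the flow of a vector field $Z$ at time $t$.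
   Context: The octonions $\mathbb{O}$ are the real algebra with vector space basis $e_0,e_1,\dots,e_7$, unit $e_0=1$, and products $e_ie_j=-\delta_{ij}+\sum_{k=1}^7\epsilon_{ijk}e_k$ for $i,j\in\{1,\dots,7\}$, where $\epsilon_{ijk}$ is completely antisymmetric, equal to $1$ for $ijk=123,145,167,246,275,374,365$, and $0$ whenever $(i,j,k)$ is not a permutation of one of these triples. The imaginary octonions (span of $e_1,\dots,e_7$) are identified with $\mathbb{R}^7$ with its standard scalar product $\langle\cdot,\cdot\rangle$. The cross product on $\mathbb{R}^7$ is $u\times v:=\frac12(u\cdot v-v\cdot u)$. The constant-coefficient $3$-form $\widetilde\omega$ on $\mathbb{R}^7$ is $\widetilde\omega(u,v,w)=\langle u\times v,w\rangle$. Let $j:\mathbb{S}^6\hookrightarrow\mathbb{R}^7$ be the inclusion of the unit sphere and $\omega:=j^*\widetilde\omega\in\Omega^3(\mathbb{S}^6)$. The almost complex structure $J$ on $\mathbb{S}^6$ is $J_p(u):=p\times u$ for $p\in\mathbb{S}^6$, $u\in T_p\mathbb{S}^6=p^\perp$. That $D$ is a singular $J$-holomorphic foliation means: $D$ is an integrable singular distribution, i.e. $\mathbb{S}^6$ is partitioned into connected injectively immersed submanifolds (leaves) $L$ with $T_qL=D_q$ for all $q\in L$ (the dimension of leaves may vary), and $J_q(D_q)=D_q$ for all $q$. A smooth map $\psi:\Sigma\to\mathbb{S}^6$ from a $2$-dimensional manifold with co-volume $\gamma$ (a nowhere vanishing bivector field on $\Sigma$) solves the dynamical Hamilton-de Donder-Weyl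 equation with respect to a function $H$ if $\iota_{(\psi_* )_x(\gamma_x)}\omega_{\psi(x)}=-(dH)_{\psi(x)}$ for all $x\in\Sigma$; contraction is $\iota_{u\wedge v}=\iota_v\iota_u$. *)

(* Defs.v *)
(* The sphere S^6 is handled as an embedded
   submanifold of R^7: tensor fields and maps on S^6 are functions on R^7 of
   which only the values at points of the sphere matter. *)
From HB Require Import structures.
From mathcomp Require Import all_boot all_order all_algebra.
From mathcomp Require Import all_classical all_reals all_analysis.

Set Implicit Arguments.
Unset Strict Implicit.
Unset Printing Implicit Defensive.

Import Order.TTheory GRing.Theory Num.Theory.
Import numFieldNormedType.Exports.
Local Open Scope classical_set_scope.
Local Open Scope ring_scope.

Section Smooth.
Context {R : realType} {V W : normedModType R}.

(* [Ck k U f]: f is of class C^k on the open set U. *)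
Fixpoint Ck (k : nat) (U : set V) (f : V -> W) : Prop :=
  if k is k'.+1 then
    (forall x, U x -> differentiable f x) /\
    (forall v : V, Ck k' U (fun x => 'D_v f x))
  else forall x, U x -> {for x, continuous f}.

Definition smooth_on (U : set V) (f : V -> W) : Prop := forall k, Ck k U f.

End Smooth.

Section ImmersedSubmanifolds.
Context {R : realType} {n : nat}.

(* A countable smooth atlas of dimension k on the subset L of R^n, for which
   the inclusion of L in R^n is an immersion.  The atlas is given by the
   inverses [f i : U i -> L] of the charts; it is indexed by nat (so that the
   manifold topology is second countable; U i may be empty).  That topology, in
   general finer than the induced one, is Hausdorff because the inclusion is
   continuous and injective.  The last clause says that each change of charts
   has an open domain and is smooth. *)
Definition immersed_atlas (k : nat) (L : set 'rV[R]_n)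
    (U : nat -> set 'rV[R]_k) (f : nat -> 'rV[R]_k -> 'rV[R]_n) : Prop :=
  [/\ \bigcup_i (f i @` U i) = L,
      forall i, open (U i) /\ set_inj (U i) (f i),
      forall i, smooth_on (U i) (f i),
      forall i x, U i x -> injective ('d (f i) x)
    & forall i j x, U i x -> (f j @` U j) (f i x) ->
        exists (N : set 'rV[R]_k) (h : 'rV[R]_k -> 'rV[R]_k),
          [/\ open N, N x, N `<=` U i, smooth_on N h
            & forall y, N y -> U j (h y) /\ f j (h y) = f i y]].

Definition atlas_open (k : nat)
    (U : nat -> set 'rV[R]_k) (f : nat -> 'rV[R]_k -> 'rV[R]_n)
    (O : set 'rV[R]_n) : Prop :=
  forall i, open (U i `&` f i @^-1` O).

(* Connectedness of L for its manifold topology. *)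
Definition atlas_connected (k : nat) (L : set 'rV[R]_n)
    (U : nat -> set 'rV[R]_k) (f : nat -> 'rV[R]_k -> 'rV[R]_n) : Prop :=
  forall O, O `<=` L -> O !=set0 ->
    atlas_open U f O -> atlas_open U f (L `\` O) -> O = L.

Definition atlas_tangent (k : nat)
    (U : nat -> set 'rV[R]_k) (f : nat -> 'rV[R]_k -> 'rV[R]_n)
    (q : 'rV[R]_n) : set 'rV[R]_n :=
  [set w | exists i x, [/\ U i x, f i x = q & exists v, w = 'd (f i) x v]].

(* L is a connected injectively immersed submanifold with T_q L = D_q. *)
Definition is_leaf (D : 'rV[R]_n -> {vspace 'rV[R]_n}) (L : set 'rV[R]_n) :
    Prop :=
  exists (k : nat) (U : nat -> set 'rV[R]_k) (f : nat -> 'rV[R]_k -> 'rV[R]_n),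
    [/\ immersed_atlas L U f, atlas_connected L U f
      & forall q, L q -> atlas_tangent U f q = [set w | w \in D q]].

End ImmersedSubmanifolds.

Section Octonions.
Context {R : realType}.

(* Octonions: coordinate 0 is the real part, coordinates 1..7 are imaginary. *)
Definition octonion := 'rV[R]_(1 + 7).

Definition oct_e (i : 'I_(1 + 7)) : octonion := delta_mx 0 i.

Definition oct_triples : seq (nat * nat * nat) :=
  [:: (1, 2, 3); (1, 4, 5); (1, 6, 7); (2, 4, 6); (2, 7, 5); (3, 7, 4);
      (3, 6, 5)]%N.

Definition even_perm_of (t s : nat * nat * nat) : bool :=
  let: (i, j, k) := t in s \in [:: (i, j, k); (j, k, i); (k, i, j)].

Definition oct_eps (i j k : nat) : R :=
  if has (even_perm_of (i, j, k)) oct_triples then 1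
  else if has (even_perm_of (j, i, k)) oct_triples then -1
  else 0.

Definition oct_mul_basis (i j : 'I_(1 + 7)) : octonion :=
  if i == 0 then oct_e j
  else if j == 0 then oct_e i
  else (- (i == j)%:R) *: oct_e 0
       + \sum_(k < 1 + 7 | k != 0) oct_eps i j k *: oct_e k.

Definition oct_mul (x y : octonion) : octonion :=
  \sum_i \sum_j (x 0 i * y 0 j) *: oct_mul_basis i j.

Definition oct_of_im (u : 'rV[R]_7) : octonion := row_mx 0 u.
Definition im_of_oct (x : octonion) : 'rV[R]_7 := rsubmx x.

(* u v - v u is always imaginary, so that im_of_oct forgets nothing here. *)
Definition cross (u v : 'rV[R]_7) : 'rV[R]_7 :=
  im_of_oct (2^-1 *: (oct_mul (oct_of_im u) (oct_of_im v)
                      - oct_mul (oct_of_im v) (oct_of_im u))).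

Definition dot (u v : 'rV[R]_7) : R := \sum_i u 0 i * v 0 i.

Definition omega_tilde (u v w : 'rV[R]_7) : R := dot (cross u v) w.

End Octonions.

Section Sphere.
Context {R : realType}.
Local Notation V := 'rV[R]_7.

Definition S6 : set V := [set p | dot p p = 1].
Definition TS6 (p : V) : set V := [set u | dot p u = 0].

Definition Jstr (p u : V) : V := cross p u.

Definition smooth_S6 {W : normedModType R} (F : V -> W) : Prop :=
  forall p, S6 p -> exists (U : set V) (G : V -> W),
    [/\ open U, U p, smooth_on U G & forall x, U x -> S6 x -> G x = F x].

Definition vector_field (X : V -> V) : Prop :=
  smooth_S6 X /\ forall p, S6 p -> TS6 p (X p).

Definition Jfield (X : V -> V) : V -> V := fun p => Jstr p (X p).

Definition normalize (x : V) : V := (Num.sqrt (dot x x))^-1 *: x.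

(* The differential at p in S^6 of a map F defined on S^6, at a tangent
   vector u: the derivative at t = 0 of F along the curve
   t |-> (p + t u) / |p + t u| of S^6, whose velocity at t = 0 is u. *)
Definition dS6 {W : normedModType R} (F : V -> W) (p u : V) : W :=
  'D_u (F \o normalize) p.

(* The Lie bracket of vector fields of a submanifold of R^7, with the sign
   for which [X, Y] f = X (Y f) - Y (X f). *)
Definition lie_bracket (X Y : V -> V) (p : V) : V :=
  dS6 Y p (X p) - dS6 X p (Y p).

(* (L_X J)(Y), from the Leibniz rule L_X (J Y) = (L_X J) Y + J (L_X Y) and
   L_X Y = [X, Y]. *)
Definition lie_derivative_J (X Y : V -> V) (p : V) : V :=
  lie_bracket X (Jfield Y) p - Jstr p (lie_bracket X Y p).

Definition lie_derivative_J_eq0 (X : V -> V) : Prop :=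
  forall Y, vector_field Y -> forall p, S6 p -> lie_derivative_J X Y p = 0.

Definition is_flow (Z : V -> V) (phi : R -> V -> V) : Prop :=
  forall p, S6 p ->
    [/\ phi 0 p = p,
        forall t, S6 (phi t p)
      & forall t : R, is_derive t 1 (fun s : R => phi s p) (Z (phi t p))].

(* The (global) flow of a vector field on the compact manifold S^6; its values
   at points of S^6 are determined by is_flow. *)
Definition flow (Z : V -> V) : R -> V -> V :=
  xget ((fun _ p => p) : R -> V -> V) [set phi | is_flow Z phi].

Definition psi (X Y : V -> V) (p : V) (t : 'rV[R]_2) : V :=
  flow Y (t 0 1) (flow X (t 0 0) p).

(* The dynamical Hamilton-de Donder-Weyl equation on R^2 with the standard
   co-volume d/dt1 /\ d/dt2, for omega = j^* omega_tilde: the contraction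
   i_{u /\ v} omega = i_v i_u omega is the form w |-> omega(u, v, w), where w
   ranges over the tangent vectors of S^6. *)
Definition solves_HDW (H : V -> R) (Psi : 'rV[R]_2 -> V) : Prop :=
  [/\ smooth_on setT Psi,
      forall t, S6 (Psi t)
    & forall t w, TS6 (Psi t) w ->
        omega_tilde ('d Psi t (delta_mx 0 0)) ('d Psi t (delta_mx 0 1)) w
        = - dS6 H (Psi t) w].

Definition spanXJX (X : V -> V) (p : V) : {vspace V} :=
  <<[:: X p; Jstr p (X p)]>>%VS.

(* D is a singular J-holomorphic foliation of S^6, with F as set of leaves. *)
Definition J_holomorphic_foliation (D : V -> {vspace V}) (F : set (set V)) :
    Prop :=
  [/\ forall q, S6 q -> [set u | u \in D q] `<=` TS6 q,
      partition F id S6,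
      forall L, F L -> is_leaf D L
    & forall q, S6 q -> Jstr q @` [set u | u \in D q] = [set u | u \in D q]].

End Sphere.

(* Main.v *)
Require Import Defs.
From HB Require Import structures.
From mathcomp Require Import all_boot all_order all_algebra.
From mathcomp Require Import all_classical all_reals all_analysis.
From mathcomp Require Import ring lra.
Import Order.TTheory GRing.Theory Num.Theory.
Import numFieldNormedType.Exports.
Local Open Scope classical_set_scope.
Local Open Scope ring_scope.

(** Part (i) is formal: the Leibniz rule that defines L_X J, applied to X
    itself, reads (L_X J) X = [X, JX] - J [X, X], and [X, X] = 0.

    For part (ii) put Y = JX, again a vector field on the sphere.  When
    [X, Y] = 0 the flows of X and Y commute ([flows_commute]), so the map psi is
    the orbit map of an action of the group R^2 ([psiD]), and its derivative at
    t in the direction (a, b) is a X + b Y taken at psi p t ([psi_is_diff]).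
    The orbits of an action partition the sphere.  The derivative of psi p is a
    smooth function of psi p, so psi p is as smooth as one likes by induction
    ([smooth_psi]).

    Since q x X is orthogonal to X and of the same length, X and JX are
    independent wherever X is nonzero.  Hence an orbit is either a fixed point
    ([is_leaf_point]) or is immersed by its orbit map ([is_leaf_surface]).  In
    the latter case the periods of psi p are isolated ([psi_isolated]): on balls
    that are small compared with the shortest period psi p is injective, these
    restrictions form an atlas, and the changes of charts are translations by
    periods.  The dynamical equation holds because X x (q x X) = |X|^2 q is
    normal to the sphere, so that omega(X, JX, w) = 0 = - dH(w) for w tangent.

    The analysis behind this is as follows.  A field X on the sphere extends
    smoothly to R^7 minus the origin by X (x / |x|); compactness turns the C^2
    regularity of the extension into a second order Taylor estimate and a
    Lipschitz estimate that are uniform on the sphere ([vector_field_taylor],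
    [vector_field_lipschitz]).  The other extension |x| X (x / |x|) is Lipschitz
    on all of R^7 and tangent to every sphere centred at 0, so its integral
    curves, which Picard iteration provides for all times at once
    ([picard_lindelof]), stay on the sphere: this is the global flow.

    Commutation of the flows is a Gronwall argument.  For small h set
      r(t) = phi^Y_t (phi^X_h p) - phi^Y_t p - h X (phi^Y_t p).
    Because DX.Y = DY.X, Taylor expansion gives r' = DY.r + O(h^2), and
    r(0) = O(h^2); therefore r(t) = O(h^2) ([flow_transport]).  In other words,
    the flow of Y maps integral curves of X to integral curves of X. *)

Set Implicit Arguments.
Unset Strict Implicit.
Unset Printing Implicit Defensive.

(** * Differentiation of row-valued maps and the classes C^k *)

Section RowCalculus.
Context {R : realType}.

Lemma normr_coord_le n (x : 'rV[R]_n) (j : 'I_n) : `|x 0 j| <= `|x|.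
Proof.
rewrite [leRHS]/Num.Def.normr/= mx_normrE.
exact: (le_bigmax _ (fun ij => `|x ij.1 ij.2|) (0, j)).
Qed.

Lemma normr_row_le n (x : 'rV[R]_n) (c : R) :
  0 <= c -> (forall j, `|x 0 j| <= c) -> `|x| <= c.
Proof.
move=> c0 xc; rewrite [leLHS]/Num.Def.normr/= mx_normrE.
by apply: bigmax_le => // -[i j] _ /=; rewrite (ord1 i).
Qed.

Context {V : normedModType R}.

Lemma is_derive_row n (f : V -> 'rV[R]_n) (x v : V) (d : 'rV[R]_n) :
  (forall j, is_derive x v (fun y => f y 0 j) (d 0 j)) -> is_derive x v f d.
Proof.
move=> fd; have df : derivable f x v.
  by apply/derivable_mxP => i j; rewrite (ord1 i); have [] := fd j.
apply: DeriveDef => //; rewrite derive_mx//; apply/rowP => j; rewrite mxE.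
by have [] := fd j.
Qed.

Lemma is_derive_coord n (f : V -> 'rV[R]_n) (x v : V) (d : 'rV[R]_n) j :
  is_derive x v f d -> is_derive x v (fun y => f y 0 j) (d 0 j).
Proof.
move=> [fd <-]; apply: DeriveDef; first exact: (derivable_mxP f x v).1.
by rewrite derive_mx// mxE.
Qed.

Lemma derive_coord n (f : V -> 'rV[R]_n) (x v : V) j :
  derivable f x v -> 'D_v (fun y => f y 0 j) x = 'D_v f x 0 j.
Proof. by move=> fd; rewrite derive_mx// mxE. Qed.

Lemma row_coordE n (f : V -> 'rV[R]_n) :
  f = \sum_(j < n) (fun x => f x 0 j *: delta_mx 0 j).
Proof. by apply/funext => x; rewrite fct_sumE [LHS]row_sum_delta. Qed.

Lemma differentiable_rowP n (f : V -> 'rV[R]_n) x :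
  differentiable f x -> forall j, differentiable (fun y => f y 0 j) x.
Proof.
move=> fd j; apply: (@differentiable_comp _ _ _ _ f (fun M : 'rV[R]_n => M 0 j)) => //.
exact: differentiable_coord.
Qed.

End RowCalculus.

Section Differentiation.
Context {R : realType}.

Lemma diff_derive (V W : normedModType R) (f : V -> W) x v :
  differentiable f x -> 'd f x v = 'D_v f x.
Proof. by move=> fd; rewrite deriveE. Qed.

Lemma derive_lincomb (W : normedModType R) n (f : 'rV[R]_n -> W) x v :
  differentiable f x ->
  'D_v f x = \sum_j v 0 j *: 'D_(delta_mx 0 j) f x.
Proof.
move=> fd; rewrite -diff_derive// {1}[v]row_sum_delta linear_sum.
by apply: eq_bigr => j _; rewrite linearZ/= diff_derive.
Qed.

Lemma derive_real_dir (W : normedModType R) (g : R -> W) (y c : R) :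
  differentiable g y -> 'D_c g y = c *: 'D_1 g y.
Proof.
by move=> gd; rewrite -!diff_derive// -linearZ/= [c *: 1 in RHS]mulr1.
Qed.

Lemma derive_comp (V U W : normedModType R) (f : U -> W) (g : V -> U) x v :
  differentiable g x -> differentiable f (g x) ->
  'D_v (f \o g) x = 'D_('D_v g x) f (g x).
Proof.
move=> gd fd; rewrite deriveE; last exact: differentiable_comp.
by rewrite diff_comp//= !diff_derive.
Qed.

Lemma derive_comp_row (V W : normedModType R) n (f : 'rV[R]_n -> W)
  (g : V -> 'rV[R]_n) x v :
  differentiable g x -> differentiable f (g x) ->
  'D_v (f \o g) x =
  \sum_j 'D_v (fun y => g y 0 j) x *: 'D_(delta_mx 0 j) f (g x).
Proof.
move=> gd fd; rewrite derive_comp// derive_lincomb//.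
by apply: eq_bigr => j _; rewrite derive_coord//; apply: diff_derivable.
Qed.

Lemma is_derive_comp_curve (V W : normedModType R) (f : V -> W) (c : R -> V) (t : R) d :
  is_derive t 1 c d -> differentiable f (c t) ->
  is_derive t 1 (f \o c) ('D_d f (c t)).
Proof.
move=> [cd <-] fd; have /derivable1_diffP cd' := cd.
apply: DeriveDef; first exact/derivable1_diffP/differentiable_comp.
rewrite deriveE; last exact: differentiable_comp.
by rewrite diff_comp//= !diff_derive.
Qed.

(** A criterion with explicit epsilons: the estimates of flows below bound a
    remainder directly. *)
Lemma differentiable_bound (V W : normedModType R) (f : V -> W) x
    (l : {linear V -> W}) :
  continuous l ->
  (forall e, 0 < e -> \forall h \near 0, `|f (h + x) - f x - l h| <= e * `|h|) ->
  is_diff x f l.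
Proof.
move=> lc fl.
have E : f \o shift x = cst (f x) + l +o_ 0 id.
  apply/eqaddoP => e e0; have := fl e e0; apply: filterS => h.
  by rewrite !fctE/= opprD addrA.
have D := diff_unique lc E.
apply: DiffDef => //; apply/diff_locallyP; rewrite D; split => //.
Qed.

Lemma bound_differentiable (V W : normedModType R) (f : V -> W) x :
  differentiable f x ->
  forall e, 0 < e ->
  \forall h \near 0, `|f (h + x) - f x - 'd f x h| <= e * `|h|.
Proof.
move=> /diff_locallyP[_ /eqaddoP fl] e e0; have := fl e e0; apply: filterS => h.
by rewrite !fctE/= opprD addrA.
Qed.

Lemma near_eq_differentiable (V W : normedModType R) (f g : V -> W) x :
  (\near x, f x = g x) -> differentiable f x -> differentiable g x.
Proof.
move=> fg fd; have fgx := nbhs_singleton fg.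
have fg' : \forall h \near 0, f (h + x) = g (h + x).
  move: fg; rewrite (near_shift 0 x) => /=.
  by apply: filterS => h; rewrite subr0.
suff : is_diff x g ('d f x) by move=> ?; exact: ex_diff.
apply: differentiable_bound => [|e e0]; first exact: diff_continuous.
have := bound_differentiable fd e0.
by move: fg'; apply: filterS2 => h <-; rewrite -fgx.
Qed.

End Differentiation.

Section SmoothCalculus.
Context {R : realType} {V : normedModType R}.
Implicit Types (k : nat) (U : set V).

Lemma Ck_eq (W : normedModType R) k U (f g : V -> W) :
  open U -> {in U, f =1 g} -> Ck k U f -> Ck k U g.
Proof.
move=> oU; elim: k f g => [|k IH] f g fg /=.
  move=> fc x Ux; have fgx := fg x (mem_set Ux).
  suff : g @ x --> f x by rewrite fgx.
  apply: cvg_trans (fc x Ux); apply: near_eq_cvg.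
  have : \forall y \near x, U y by exact: open_nbhs_nbhs.
  by apply: filterS => y Uy; rewrite fg ?inE.
have nfg x : U x -> \forall y \near x, f y = g y.
  move=> Ux; have : \forall y \near x, U y by exact: open_nbhs_nbhs.
  by apply: filterS => y Uy; rewrite fg ?inE.
move=> [fd fD]; split.
  move=> x Ux; apply: near_eq_differentiable (fd x Ux).
  exact: nfg.
move=> v; apply: IH (fD v) => x /set_mem Ux.
by apply: near_eq_derive; exact: nfg.
Qed.

Lemma Ck_local (W : normedModType R) k U (f : V -> W) :
  (forall x, U x -> exists U', [/\ open U', U' x & Ck k U' f]) -> Ck k U f.
Proof.
elim: k f => [|k IH] f Uf /=.
  by move=> x Ux; have [U' [_ U'x]] := Uf x Ux; apply.
split=> [x Ux|v]; first by have [U' [_ U'x [+ _]]] := Uf x Ux; apply.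
apply: IH => x Ux; have [U' [oU' U'x [_ fD]]] := Uf x Ux.
by exists U'; split => //; exact: fD.
Qed.

Lemma CkS_W (W : normedModType R) k U (f : V -> W) : Ck k.+1 U f -> Ck k U f.
Proof.
elim: k f => [|k IH] f [fd fD]; last by split=> // v; exact: IH (fD v).
by move=> x Ux; exact/differentiable_continuous/fd.
Qed.

Lemma Ck_sub (W : normedModType R) k U U' (f : V -> W) :
  U' `<=` U -> Ck k U f -> Ck k U' f.
Proof.
move=> UU; elim: k f => [|k IH] f /=; first by move=> fc x /UU; exact: fc.
by move=> [fd fD]; split => [x /UU|v]; [exact: fd|exact: IH (fD v)].
Qed.

Lemma Ck_cst (W : normedModType R) k U (w : W) : Ck k U (fun _ : V => w).
Proof.
elim: k w => [|k IH] w /=; first by move=> x _; exact: cvg_cst.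
split=> [x _|v]; first exact: differentiable_cst.
have -> : (fun x : V => 'D_v (fun=> w) x) = (fun=> 0).
  by apply/funext => x; exact: derive_cst.
exact: IH.
Qed.

Lemma Ck_linear (W : normedModType R) k U (f : {linear V -> W}) :
  continuous f -> Ck k U f.
Proof.
move=> fc; case: k => [|k] /=; first by move=> x _; exact: fc.
have fd x : differentiable f x by exact: linear_differentiable.
split=> [//|v].
have -> : (fun x : V => 'D_v f x) = (fun=> f v).
  by apply/funext => x; rewrite deriveE// diff_lin.
exact: Ck_cst.
Qed.

Lemma Ck_id k U : Ck k U (fun x : V => x).
Proof. by apply: (Ck_linear k U (f := idfun)) => x; exact: cvg_id. Qed.

Lemma CkD (W : normedModType R) k U (f g : V -> W) : open U ->
  Ck k U f -> Ck k U g -> Ck k U (fun x => f x + g x).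
Proof.
move=> oU; elim: k f g => [|k IH] f g /=.
  by move=> fc gc x Ux; apply: cvgD; [exact: fc|exact: gc].
move=> [fd fD] [gd gD]; split=> [x Ux|v].
  by apply: differentiableD; [exact: fd|exact: gd].
apply: Ck_eq (IH _ _ (fD v) (gD v)) => // x /set_mem Ux.
by rewrite [RHS]deriveD//; apply: diff_derivable; [exact: fd|exact: gd].
Qed.

Lemma Ck_sum (W : normedModType R) k U n (f : 'I_n -> V -> W) : open U ->
  (forall i, Ck k U (f i)) -> Ck k U (fun x => \sum_i f i x).
Proof.
move=> oU; elim: n f => [|n IH] f fk.
  apply: Ck_eq (Ck_cst k U (0 : W)) => // x _; by rewrite big_ord0.
apply: Ck_eq (CkD oU (IH (fun i => f (widen_ord (leqnSn n) i)) _) (fk ord_max)) => //.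
by move=> x _; rewrite big_ord_recr.
Qed.

Lemma CkM k U (f g : V -> R) : open U ->
  Ck k U f -> Ck k U g -> Ck k U (fun x => f x * g x).
Proof.
move=> oU; elim: k f g => [|k IH] f g.
  by move=> /= fc gc x Ux; apply: cvgM; [exact: fc|exact: gc].
move=> fk gk; have [fd fD] := fk; have [gd gD] := gk; split=> [x Ux|v].
  by apply: differentiableM; [exact: fd|exact: gd].
apply: Ck_eq (CkD oU (IH _ _ (CkS_W fk) (gD v)) (IH _ _ (CkS_W gk) (fD v))) => //.
move=> x /set_mem Ux.
by rewrite [RHS]deriveM//; apply: diff_derivable; [exact: fd|exact: gd].
Qed.

Lemma CkZl (W : normedModType R) k U (f : V -> R) (w : W) : open U ->
  Ck k U f -> Ck k U (fun x => f x *: w).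
Proof.
move=> oU; elim: k f => [|k IH] f /=.
  by move=> fc x Ux; apply: cvgZr_tmp; exact: fc.
move=> [fd fD]; split=> [x Ux|v]; first by apply: differentiableZl; exact: fd.
apply: Ck_eq (IH _ (fD v)) => // x /set_mem Ux.
rewrite [RHS]deriveE; last by apply: differentiableZl; exact: fd.
by rewrite diffZl ?deriveE//; exact: fd.
Qed.

Lemma Ck_coord k U n (f : V -> 'rV[R]_n) j : open U ->
  Ck k U f -> Ck k U (fun x => f x 0 j).
Proof.
move=> oU; elim: k f => [|k IH] f /=.
  move=> fc x Ux; apply: (cvg_comp _ (fun M : 'rV[R]_n => M 0 j)) (fc x Ux) _.
  exact: coord_continuous.
move=> [fd fD]; split=> [x Ux|v]; first exact/differentiable_rowP/fd.
apply: Ck_eq (IH _ (fD v)) => // x /set_mem Ux.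
by rewrite derive_coord//; apply: diff_derivable; exact: fd.
Qed.

Lemma Ck_row k U n (f : V -> 'rV[R]_n) : open U ->
  (forall j, Ck k U (fun x => f x 0 j)) -> Ck k U f.
Proof.
move=> oU fk.
apply: Ck_eq (Ck_sum oU (fun j => CkZl (delta_mx 0 j) oU (fk j))) => //.
by move=> x _; rewrite [RHS]row_sum_delta.
Qed.

Lemma CkZr k U n (f : V -> R) (g : V -> 'rV[R]_n) :
  open U -> Ck k U f -> Ck k U g -> Ck k U (fun x => f x *: g x).
Proof.
move=> oU fk gk; apply: Ck_row => // j.
have -> : (fun x => (f x *: g x) 0 j) = (fun x => f x * g x 0 j).
  by apply/funext => x; rewrite mxE.
by apply: CkM => //; exact: Ck_coord.
Qed.

End SmoothCalculus.

Section SmoothComposition.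
Context {R : realType} {V : normedModType R}.

(** The chain rule expresses the derivatives of f o g through products of
    derivatives of g with compositions of derivatives of f, which the
    induction on k covers. *)
Lemma Ck_comp_scalar k (U : set V) n (U' : set 'rV[R]_n) (g : V -> 'rV[R]_n)
    (f : 'rV[R]_n -> R) : open U -> (forall x, U x -> U' (g x)) ->
  Ck k U g -> Ck k U' f -> Ck k U (f \o g).
Proof.
move=> oU gU; elim: k f => [|k IH] f.
  by move=> /= gc fc x Ux; apply: continuous_comp; [exact: gc|exact/fc/gU].
move=> gk [fd fD]; have [gd gD] := gk; split=> [x Ux|v].
  by apply: differentiable_comp; [exact: gd|exact/fd/gU].
have /(Ck_sum oU) : forall j : 'I_n, Ck k U (fun x => 'D_v g x 0 j *
     ((fun y => 'D_(delta_mx 0 j) f y) \o g) x).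
  move=> j; apply: CkM => //; first exact: (Ck_coord j oU (gD v)).
  exact: (IH _ (CkS_W gk) (fD _)).
apply: Ck_eq => // x /set_mem Ux.
rewrite [RHS]derive_comp_row; [|exact: gd|exact/fd/gU].
by apply: eq_bigr => j _; rewrite derive_coord//; exact/diff_derivable/gd.
Qed.

Lemma Ck_comp k (U : set V) n m (U' : set 'rV[R]_n) (g : V -> 'rV[R]_n)
    (f : 'rV[R]_n -> 'rV[R]_m) : open U -> open U' ->
  (forall x, U x -> U' (g x)) -> Ck k U g -> Ck k U' f -> Ck k U (f \o g).
Proof.
move=> oU oU' gU gk fk; apply: Ck_row => // j.
exact: (Ck_comp_scalar oU gU gk (Ck_coord j oU' fk)).
Qed.

End SmoothComposition.

(** * Comparison, Gronwall and primitives on the real line *)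

Section RealCalculus.
Context {R : realType}.
Implicit Types (f df g dg : R -> R).

Lemma derive_continuous (V : normedModType R) (f df : R -> V) :
  (forall t : R, is_derive t 1 f (df t)) -> continuous f.
Proof.
by move=> fd t; apply/differentiable_continuous/derivable1_diffP; case: (fd t).
Qed.

Lemma is_derive_mean f df s t : (forall t : R, is_derive t 1 f (df t)) -> s <= t ->
  exists c, [/\ s <= c, c <= t & f t - f s = df c * (t - s)].
Proof.
move=> fd st; have [//|c] := @MVT_segment R f df s t st (fun x _ => fd x).
  by apply: continuous_subspaceT; exact: derive_continuous fd.
by rewrite in_itv/= => /andP[sc ct] E; exists c.
Qed.

Lemma is_derive_opp_arg (V : normedModType R) (f df : R -> V) :
  (forall t : R, is_derive t 1 f (df t)) ->
  forall t : R, is_derive t 1 (fun s => f (- s)) (- df (- t)).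
Proof.
move=> fd t; have dN : is_derive t (1 : R) (-%R : R -> R) (-1).
  exact: is_deriveNid.
have fdt := fd (- t); have [fdN _] := fdt.
have := is_derive_comp_curve dN ((derivable1_diffP _ _).1 fdN).
rewrite derive_real_dir; last exact/derivable1_diffP.
by rewrite scaleN1r derive_val.
Qed.

Lemma derive_ge0_le f df s t : (forall t : R, is_derive t 1 f (df t)) -> s <= t ->
  (forall c, s <= c -> c <= t -> 0 <= df c) -> f s <= f t.
Proof.
move=> fd st df0; have [c [sc ct E]] := is_derive_mean fd st.
by rewrite -subr_ge0 E mulr_ge0 ?subr_ge0 ?df0.
Qed.

Lemma is_derive_expR_scale (a t : R) :
  is_derive t 1 (fun s : R => expR (a * s)) (a * expR (a * t)).
Proof.
have da : is_derive t 1 (fun s : R => a * s) a.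
  by apply: is_derive_eq; rewrite [LHS]mulr1.
have de := is_derive_expR (a * t); have [ded dee] := de.
have := is_derive_comp_curve da ((derivable1_diffP _ _).1 ded).
by rewrite derive_real_dir ?dee//; exact/derivable1_diffP.
Qed.

(** Both K exp (a t) + f t and K exp (a t) - f t are nondecreasing for t >=
    0. *)
Lemma derive_exp_bound_ge0 f df (K a t : R) : 0 <= t ->
  (forall t : R, is_derive t 1 f (df t)) ->
  (forall t, `|df t| <= K * (a * expR (a * `|t|))) ->
  `|f t - f 0| <= K * (expR (a * t) - 1).
Proof.
move=> t0 fd dfb.
have hd (e s : R) : is_derive s 1 (fun s => K * expR (a * s) + e * f s)
    (K * (a * expR (a * s)) + e * df s).
  have ? := fd s; have ? := is_derive_expR_scale a s.
  by apply: is_derive_eq; rewrite ?scaler0 ?addr0 ?add0r.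
have h0 e : `|e| = 1 ->
    K * expR (a * 0) + e * f 0 <= K * expR (a * t) + e * f t.
  move=> e1; apply: (derive_ge0_le (hd e) t0) => c c0 _.
  have := ler_norm (- (e * df c)); rewrite normrN normrM e1 mul1r.
  by have := dfb c; rewrite (ger0_norm c0); lra.
have := h0 1 (normr1 _); have := h0 (-1) (normrN1 _).
rewrite mulr0 expR0 ler_norml; lra.
Qed.

(** The weight exp (a |t|) is what lets Picard iteration converge on the whole
    line at once: integrating a bound proportional to it gains a factor 1 /
    a. *)
Lemma derive_exp_bound f df (K a t : R) :
  (forall t : R, is_derive t 1 f (df t)) ->
  (forall t, `|df t| <= K * (a * expR (a * `|t|))) ->
  `|f t - f 0| <= K * (expR (a * `|t|) - 1).
Proof.
move=> fd dfb; have [t0|t0] := leP 0 t.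
  by rewrite (ger0_norm t0); exact: derive_exp_bound_ge0 fd dfb.
rewrite (ltr0_norm t0); have Nt0 : 0 <= - t by rewrite oppr_ge0 ltW.
have := derive_exp_bound_ge0 Nt0 (is_derive_opp_arg fd) _.
rewrite opprK oppr0; apply => s.
by rewrite normrN; have := dfb (- s); rewrite normrN.
Qed.

(** The product g t exp (- A t) is nonincreasing. *)
Lemma gronwall_ge0 g dg (A t : R) : 0 <= t ->
  (forall t : R, is_derive t 1 g (dg t)) ->
  (forall s, `|s| <= t -> `|dg s| <= A * g s) -> g t <= g 0 * expR (A * t).
Proof.
move=> t0 gd gb.
have hd (s : R) : is_derive s 1 (fun s => - (g s * expR (- A * s)))
    (- (g s * (- A * expR (- A * s)) + expR (- A * s) * dg s)).
  by have ? := gd s; have ? := is_derive_expR_scale (- A) s; apply: is_derive_eq.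
have := derive_ge0_le hd t0; rewrite mulr0 expR0 mulr1 lerN2 => H.
rewrite -ler_pdivrMr ?expR_gt0// -expRN -mulNr; apply: H => c c0 ct.
rewrite [leRHS](_ : _ = expR (- A * c) * (A * g c - dg c)); last by ring.
rewrite mulr_ge0 ?expR_ge0// subr_ge0 (le_trans (ler_norm _))//.
by apply: gb; rewrite ger0_norm.
Qed.

Lemma gronwall g dg (A t : R) :
  (forall t : R, is_derive t 1 g (dg t)) ->
  (forall s, `|s| <= `|t| -> `|dg s| <= A * g s) ->
  g t <= g 0 * expR (A * `|t|).
Proof.
move=> gd gb; have [t0|t0] := leP 0 t.
  have gb' := gb; rewrite (ger0_norm t0) in gb' *.
  exact: gronwall_ge0 gd gb'.
have gb' := gb; rewrite (ltr0_norm t0) in gb' *.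
have Nt0 : 0 <= - t by rewrite oppr_ge0 ltW.
have := gronwall_ge0 Nt0 (is_derive_opp_arg gd) _.
rewrite opprK oppr0; apply => s st; rewrite normrN.
by apply: gb'; rewrite normrN.
Qed.

(** The bound is required on the interval from - max (|s|, |t|) to max (|s|,
    |t|), which contains the segment between s and t whatever the signs;
    bounds that grow with |t| can then be used. *)
Lemma derive_bound_lip n (f df : R -> 'rV[R]_n) (M s t : R) : 0 <= M ->
  (forall t : R, is_derive t 1 f (df t)) ->
  (forall c, `|c| <= Num.max `|s| `|t| -> `|df c| <= M) ->
  `|f t - f s| <= M * `|t - s|.
Proof.
move=> M0 fd dfb; wlog st : s t dfb / s <= t.
  move=> H; have [/H|/ltW/H] := leP s t; first exact.
  by rewrite distrC (distrC s t); apply; rewrite maxC.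
apply: normr_row_le => [|j]; first by rewrite mulr_ge0.
rewrite !mxE.
have [c [sc ct ->]] := is_derive_mean (fun t => is_derive_coord j (fd t)) st.
rewrite normrM ler_wpM2r//; apply: le_trans (normr_coord_le _ _) (dfb _ _).
rewrite le_max !ler_norml.
have := ler_norm t; have := ler_norm (- s); have := ler_norm (- t); rewrite !normrN; have := ler_norm s.
have [t0|t0] := leP 0 c.
  by move=> *; apply/orP; right; apply/andP; split; lra.
by move=> *; apply/orP; left; apply/andP; split; lra.
Qed.

(** The signed integral from 0 is, near a given t, a constant plus the
    integral from a base point - N far to the left, to which the fundamental
    theorem of calculus applies. *)
Lemma continuous_primitive f : continuous f ->
  exists F : R -> R, F 0 = 0 /\ forall t : R, is_derive t 1 F (f t).
Proof.
move=> fc; pose mu := @lebesgue_measure R.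
have fi a b : mu.-integrable `[a, b] (EFin \o f).
  apply: continuous_compact_integrable; first exact: segment_compact.
  exact: continuous_subspaceT.
(* half-open at the lower end: the difference of the integrals over
   [-N, t] and [-N, 0] is the integral over ]0, t] *)
pose F (t : R) : R := if 0 <= t then \int[mu]_(x in `]0, t]) f x
            else - \int[mu]_(x in `]t, 0]) f x.
have FE (N t : R) : `|t| < N ->
    F t = \int[mu]_(x in `[- N, t]) f x - \int[mu]_(x in `[- N, 0]) f x.
  rewrite ltr_norml => /andP[Nt tN]; rewrite /F; case: leP => t0.
    by rewrite Rintegral_itvB ?bnd_simp//; lra.
  by rewrite -opprB Rintegral_itvB ?bnd_simp//; lra.
exists F; split.
  by rewrite (FE 1) ?normr0// subrr.
move=> t; pose N : R := `|t| + 1.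
have tN : `|t| < N by rewrite /N; lra.
have := tN; rewrite ltr_norml => /andP[Nt tN'].
pose G (x : R) : R := \int[mu]_(y in `[- N, x]) f y.
have Gd : derivable G t 1 /\ derive1 G t = f t.
  exact: (continuous_FTC1_closed tN' (fi _ _) Nt (fc t)).
have near_t : \forall x \near t, G x - G 0 = F x.
  have : \forall x \near t, x \in `]- N, N[.
    by apply: near_in_itvoo; rewrite in_itv/= Nt.
  by apply: filterS => x; rewrite in_itv/= => xN; rewrite -(FE N)// ltr_norml.
apply: near_eq_is_derive near_t _; clearbody G F.
have Gd' : is_derive t 1 G (f t).
  by case: Gd => Gd GE; apply: DeriveDef => //; rewrite -derive1E.
by apply: is_derive_eq; rewrite subr0.
Qed.

End RealCalculus.

(** * Gronwall and Picard-Lindelof in R^n *)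

Section Gronwall.
Context {R : realType} {n : nat}.

Lemma sum_le_const (F : 'I_n -> R) (c : R) :
  (forall j, F j <= c) -> \sum_j F j <= n%:R * c.
Proof.
move=> Fc; rewrite mulr_natl -[X in _ *+ X]card_ord -sumr_const.
by apply: ler_sum => j _; exact: Fc.
Qed.

Lemma sqr_norm_le_sum (x : 'rV[R]_n) : `|x| ^+ 2 <= \sum_j x 0 j ^+ 2.
Proof.
have s0 : 0 <= \sum_j x 0 j ^+ 2 by apply: sumr_ge0 => j _; exact: sqr_ge0.
rewrite -(sqr_sqrtr s0) lerXn2r ?nnegrE ?sqrtr_ge0//.
apply: normr_row_le => [|j]; first exact: sqrtr_ge0.
rewrite -sqrtr_sqr ler_sqrt// (bigD1 j)//= lerDl.
by apply: sumr_ge0 => i _; exact: sqr_ge0.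
Qed.

Lemma sum_le_sqr_norm (x : 'rV[R]_n) : \sum_j x 0 j ^+ 2 <= n%:R * `|x| ^+ 2.
Proof.
apply: sum_le_const => j; rewrite -[leLHS]real_normK ?num_real//.
by rewrite lerXn2r ?nnegrE// normr_coord_le.
Qed.

(** The sum of the squares of the coordinates plus c^2 is differentiable,
    unlike the maximum norm, and satisfies the scalar Gronwall inequality: 2
    <f, f'> is at most n (2 |f|) (L |f| + c), hence at most n (2 L + 1) (|f|^2
    + c^2). *)
Lemma gronwall_row (f df : R -> 'rV[R]_n) (L c t : R) : 0 <= L -> 0 <= c ->
  (forall t : R, is_derive t 1 f (df t)) ->
  (forall s, `|s| <= `|t| -> `|df s| <= L * `|f s| + c) ->
  `|f t| ^+ 2 <=
    (n%:R * `|f 0| ^+ 2 + c ^+ 2) * expR (n%:R * (2 * L + 1) * `|t|).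
Proof.
move=> L0 c0 fd fb.
pose g (t : R) : R := \sum_j f t 0 j ^+ 2 + c ^+ 2.
pose dg (t : R) : R := \sum_j (2 * f t 0 j * df t 0 j).
have gd (s : R) : is_derive s 1 g (dg s).
  have fjd j : is_derive s 1 (fun y => f y 0 j ^+ 2) (2 * f s 0 j * df s 0 j).
    have ? := is_derive_coord j (fd s); apply: is_derive_eq.
    by rewrite /GRing.scale/=; ring.
  have := @is_derive_sum _ _ _ _ (fun j y => f y 0 j ^+ 2) s 1 _ fjd.
  move=> sd; have -> : g = \sum_(j < n) (fun y => f y 0 j ^+ 2) + cst (c ^+ 2).
    by apply/funext => y; rewrite /g -[RHS]/(_ y + c ^+ 2) fct_sumE.
  by apply: is_derive_eq; rewrite addr0.
have gb s : `|s| <= `|t| -> `|dg s| <= (n%:R * (2 * L + 1)) * g s.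
  move=> /fb fbs; have n0 : 0 <= n%:R :> R by rewrite ler0n.
  apply: (@le_trans _ _ (n%:R * ((2 * L + 1) * (`|f s| ^+ 2 + c ^+ 2)))).
    apply: le_trans (ler_norm_sum _ _ _) _; apply: sum_le_const => j.
    rewrite !normrM ger0_norm//.
    have fj := normr_coord_le (f s) j; have dfj := normr_coord_le (df s) j.
    apply: (@le_trans _ _ (2 * `|f s| * (L * `|f s| + c))).
      by rewrite ler_pM ?mulr_ge0// ?ler_pM2l// (le_trans dfj).
    have F0 : 0 <= `|f s| by []; move: (`|f s|) F0 => F F0.
    have : 0 <= (F - c) ^+ 2 by exact: sqr_ge0.
    have : 0 <= L * c ^+ 2 by rewrite mulr_ge0 ?sqr_ge0.
    by nra.
  rewrite -mulrA ler_wpM2l// ler_wpM2l ?addr_ge0 ?mulr_ge0//.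
  by rewrite lerD2r sqr_norm_le_sum.
have := gronwall gd gb; rewrite {1 2}/g => H.
apply: le_trans (sqr_norm_le_sum _) _; rewrite -[leLHS]addr0.
apply: le_trans (le_trans _ H) _; first by rewrite lerD2l sqr_ge0.
by rewrite ler_wpM2r ?expR_ge0// lerD2r sum_le_sqr_norm.
Qed.

End Gronwall.

Lemma lipschitz_continuous (R : realType) (V W : normedModType R)
    (f : V -> W) (L : R) : 0 < L ->
  (forall x y, `|f x - f y| <= L * `|x - y|) -> continuous f.
Proof.
move=> L0 fL x; apply/cvgrPdist_lt => e e0.
have : \forall y \near x, `|x - y| < e / L.
  by have /cvgrPdist_lt := @cvg_id _ (nbhs x); apply; rewrite divr_gt0.
apply: filterS => y xy; apply: le_lt_trans (fL _ _) _.
by rewrite -ltr_pdivlMl// mulrC.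
Qed.

Section PicardLindelof.
Context {R : realType} {n : nat}.

Lemma geometric_half_le0 (x B : R) :
  (forall k, x <= B * 2^-1 ^+ k) -> x <= 0.
Proof.
move=> xB; have h : `|2^-1 : R| < 1 by rewrite ger0_norm ?invf_lt1 ?ltr1n.
have Bc := cvg_geometric B h.
rewrite -(cvg_lim (@Rhausdorff R) Bc).
by apply: limr_ge; [exact: cvgP Bc|apply: nearW => k; exact: xB].
Qed.

Lemma cauchy_geometric_half (u : nat -> R) (B : R) :
  (forall k, `|u k.+1 - u k| <= B * 2^-1 ^+ k) ->
  exists l, forall k, `|l - u k| <= 2 * B * 2^-1 ^+ k.
Proof.
move=> uB.
have B0 : 0 <= B by have := uB 0; rewrite expr0 mulr1; apply: le_trans.
have h0 m : 0 <= (2^-1 : R) ^+ m by rewrite exprn_ge0// invr_ge0.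
have uD k m : `|u (k + m)%N - u k| <= 2 * B * (2^-1 ^+ k - 2^-1 ^+ (k + m)).
  elim: m => [|m IH]; first by rewrite addn0 !subrr mulr0 normr0.
  have := uB (k + m)%N; rewrite addnS => uk.
  rewrite -(subrK (u (k + m)%N) (u _)) -addrA.
  apply: le_trans (ler_normD _ _) _; apply: le_trans (lerD uk IH) _.
  by rewrite exprS; lra.
have uD' k m : `|u (k + m)%N - u k| <= 2 * B * 2^-1 ^+ k.
  apply: le_trans (uD k m) _; rewrite ler_wpM2l ?mulr_ge0// gerBl.
  exact: h0.
have uc : cvgn u.
  apply/cauchy_cvgP/cauchy_exP => e e0.
  have h : `|2^-1 : R| < 1 by rewrite ger0_norm ?invf_lt1 ?ltr1n.
  have /cvgrPdist_lt/(_ _ e0)[k _ Hk] := cvg_geometric (2 * B) h.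
  exists (u k); exists k => // m /= km.
  rewrite -ball_normE /ball_/= distrC -(subnKC km).
  apply: le_lt_trans (uD' k _) _; have := Hk k (leqnn k).
  rewrite sub0r normrN ger0_norm// /geometric/=.
  by rewrite !mulr_ge0.
exists (limn u) => k.
have c1 : (fun m => `|u (m + k)%N - u k|) @ \oo --> `|limn u - u k|.
  by apply: cvg_norm; apply: cvgB; [rewrite cvg_shiftn; exact: uc|exact: cvg_cst].
rewrite -(cvg_lim (@Rhausdorff R) c1); apply: limr_le; first exact: cvgP c1.
by apply: nearW => m; rewrite addnC.
Qed.

(** Total in c, so that Picard iterates can be defined before their continuity
    is known. *)
Definition primitive (c : R -> 'rV[R]_n) : R -> 'rV[R]_n :=
  xget (fun=> 0) [set F | F 0 = 0 /\ forall t : R, is_derive t 1 F (c t)].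

Lemma primitiveP (c : R -> 'rV[R]_n) : continuous c ->
  primitive c 0 = 0 /\ forall t : R, is_derive t 1 (primitive c) (c t).
Proof.
move=> cc.
suff [F HF] : exists F : R -> 'rV[R]_n,
    F 0 = 0 /\ forall t : R, is_derive t 1 F (c t).
  exact: (@xgetI _ (fun=> 0) [set F : R -> 'rV[R]_n | F 0 = 0 /\
     forall t : R, is_derive t 1 F (c t)] F).
have cj j : continuous (fun t => c t 0 j).
  move=> t; apply: (cvg_comp _ (fun M : 'rV[R]_n => M 0 j)) (cc t) _.
  exact: coord_continuous.
pose G j := sval (cid (continuous_primitive (cj j))).
have GP j : G j 0 = 0 /\ forall t : R, is_derive t 1 (G j) (c t 0 j).
  exact: (svalP (cid (continuous_primitive (cj j)))).
exists (fun t => \row_j G j t); split.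
  by apply/rowP => j; rewrite !mxE (GP j).1.
move=> t; apply: is_derive_row => j.
have -> : (fun y => (\row_j0 G j0 y) 0 j) = G j.
  by apply/funext => y; rewrite mxE.
exact: (GP j).2.
Qed.

Variables (F : 'rV[R]_n -> 'rV[R]_n) (L : R).
Hypotheses (L0 : 0 < L) (FL : forall x y, `|F x - F y| <= L * `|x - y|).

Let F_continuous : continuous F.
Proof. exact: lipschitz_continuous L0 FL. Qed.

Fixpoint picard_iterate (p : 'rV[R]_n) (k : nat) : R -> 'rV[R]_n :=
  if k is k'.+1 then fun t => p + primitive (F \o picard_iterate p k') t
  else fun=> p.

Let lip_comp_continuous (c : R -> 'rV[R]_n) : continuous c -> continuous (F \o c).
Proof. by move=> cc t; apply: continuous_comp; [exact: cc|exact: F_continuous]. Qed.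

Let picard_map_derive p (c : R -> 'rV[R]_n) : continuous c ->
  forall t : R, is_derive t 1 (fun t => p + primitive (F \o c) t) (F (c t)).
Proof.
move=> cc t; have ? := (primitiveP (lip_comp_continuous cc)).2 t.
by apply: is_derive_eq; rewrite add0r.
Qed.

Let picard_map0 p (c : R -> 'rV[R]_n) : continuous c ->
  p + primitive (F \o c) 0 = p.
Proof. by move=> /lip_comp_continuous/primitiveP[-> _]; rewrite addr0. Qed.

Let picard_continuous p k : continuous (picard_iterate p k).
Proof.
elim: k => [|k IH] /=; first by move=> t; exact: cvg_cst.
exact: derive_continuous (picard_map_derive p IH).
Qed.

Let exp_weight (t : R) := expR (2 * L * `|t|).

Let exp_bound (f df : R -> 'rV[R]_n) (K : R) : 0 <= K ->
  (forall t : R, is_derive t 1 f (df t)) -> f 0 = 0 ->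
  (forall t, `|df t| <= K * L * exp_weight t) ->
  forall t, `|f t| <= K * 2^-1 * exp_weight t.
Proof.
move=> K0 fd f0 fb t; have e0 : 0 <= exp_weight t by exact: expR_ge0.
apply: normr_row_le => [|j]; first by rewrite !mulr_ge0// invr_ge0.
have := derive_exp_bound t (fun t => is_derive_coord j (fd t))
  (K := K * 2^-1) (a := 2 * L) _.
rewrite f0 mxE subr0 => H; apply: (le_trans (H _)) => [s|].
  apply: (le_trans (normr_coord_le _ _)); apply: le_trans (fb s) _.
  by rewrite le_eqVlt; apply/orP; left; apply/eqP; rewrite /exp_weight; field.
by rewrite ler_wpM2l ?mulr_ge0 ?invr_ge0// gerBl.
Qed.

(** Measured with the weight exp (2 L |t|), each Picard step contracts
    distances by the factor 1 / 2 ([exp_bound]).  The iterates therefore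
    converge locally uniformly on the whole line, and the limit is a fixed
    point of the Picard map. *)
Theorem picard_lindelof p :
  exists y : R -> 'rV[R]_n, y 0 = p /\ forall t : R, is_derive t 1 y (F (y t)).
Proof.
have w0 t : 0 <= exp_weight t by exact: expR_ge0.
pose u := picard_iterate p; pose B := `|F p| / (2 * L).
have B0 : 0 <= B by rewrite divr_ge0// mulr_ge0// ltW.
have uc k : continuous (u k) by exact: picard_continuous.
have u0 k : u k 0 = p by case: k => // k; exact: picard_map0.
have uS k t : `|u k.+1 t - u k t| <= B * 2^-1 ^+ k * exp_weight t.
  elim: k t => [|k IH] t.
    pose df (t : R) := F p; rewrite expr0 mulr1.
    have -> : B = (`|F p| / L) * 2^-1.
      by rewrite /B invfM; ring.
    apply: (exp_bound (f := fun t => u 1%N t - u 0%N t) (df := df)) => [|s||s].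
    - by rewrite divr_ge0// ltW.
    - have ? := picard_map_derive p (uc 0%N) s.
      by apply: is_derive_eq; rewrite subr0.
    - by rewrite !u0 subrr.
    - rewrite divfK ?gt_eqF// ler_peMr// /exp_weight -expR0 ler_expR.
      by rewrite !mulr_ge0// ltW.
  rewrite exprSr mulrA; pose df t := F (u k.+1 t) - F (u k t).
  apply: (exp_bound (f := fun t => u k.+2 t - u k.+1 t) (df := df)) => [|s||s].
  - by rewrite mulr_ge0// exprn_ge0// invr_ge0.
  - have ? := picard_map_derive p (uc k) s.
    by have ? := picard_map_derive p (uc k.+1) s; apply: is_derive_eq.
  - by rewrite !u0 subrr.
  - apply: le_trans (FL _ _) _; rewrite mulrAC mulrC ler_wpM2r ?(ltW L0)//.
clearbody B.
have lim_ex (t : R) j : exists l, forall k, `|l - u k t 0 j| <=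
    2 * (B * exp_weight t) * 2^-1 ^+ k.
  apply: cauchy_geometric_half => k.
  have := normr_coord_le (u k.+1 t - u k t) j; rewrite !mxE => H.
  by apply: le_trans H _; rewrite mulrAC; exact: uS.
(* the pointwise limit of the iterates *)
pose y (t : R) : 'rV[R]_n := \row_j sval (cid (lim_ex t j)).
have yu k t : `|y t - u k t| <= 2 * B * 2^-1 ^+ k * exp_weight t.
  apply: normr_row_le => [|j].
    by rewrite !mulr_ge0 ?exprn_ge0 ?w0 ?invr_ge0.
  rewrite !mxE; apply: le_trans (svalP (cid (lim_ex t j)) k) _.
  by rewrite le_eqVlt; apply/orP; left; apply/eqP; ring.
have h0 k : 0 <= (2^-1 : R) ^+ k by rewrite exprn_ge0// invr_ge0.
have yc : continuous y.
  move=> t; apply/cvgrPdist_lt => e e0.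
  pose E := exp_weight (`|t| + 1).
  have h : `|2^-1 : R| < 1 by rewrite ger0_norm ?invf_lt1 ?ltr1n.
  have e4 : 0 < e / 4 by rewrite divr_gt0.
  have /cvgrPdist_lt/(_ _ e4)[k _ Hk] := cvg_geometric (2 * B * E) h.
  have := Hk k (leqnn k); rewrite /= /geometric/= sub0r normrN => Ek.
  have {}Ek : 2 * B * 2^-1 ^+ k * E < e / 4.
    by rewrite mulrAC (le_lt_trans (ler_norm _)).
  have yuE s : `|s| <= `|t| + 1 -> `|y s - u k s| < e / 4.
    move=> st; apply: le_lt_trans Ek; apply: le_trans (yu k s) _.
    rewrite ler_wpM2l ?mulr_ge0// /E /exp_weight ler_expR ler_wpM2l//.
      by rewrite mulr_ge0// ltW.
    by rewrite [leRHS]ger0_norm// addr_ge0.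
  have nu : \forall s \near t, `|u k t - u k s| < e / 4.
    by have /cvgrPdist_lt := uc k t; apply.
  have nt : \forall s \near t, `|t - s| < 1.
    by have /cvgrPdist_lt := @cvg_id _ (nbhs t); apply.
  move: nu nt; apply: filterS2 => s us ts.
  have st : `|s| <= `|t| + 1.
    by rewrite -lerBlDl (le_trans (lerB_dist _ _))// distrC ltW.
  have -> : y t - y s = (y t - u k t) + (u k t - u k s) - (y s - u k s).
    by apply/rowP => j; rewrite !mxE; ring.
  apply: le_lt_trans (ler_normB _ _) _.
  have := ler_normD (y t - u k t) (u k t - u k s).
  have := yuE _ st; have : `|t| <= `|t| + 1 by rewrite lerDl.
  move=> /yuE; lra.
exists y; have zE t : p + primitive (F \o y) t = y t.
  apply/eqP; rewrite -subr_eq0 -normr_le0.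
  apply: (@geometric_half_le0 _ (2 * B * exp_weight t)) => k.
  have zu : `|p + primitive (F \o y) t - u k.+1 t| <=
      2 * B * 2^-1 ^+ k * 2^-1 * exp_weight t.
    pose df t := F (y t) - F (u k t).
    apply: (exp_bound (f := fun t => p + primitive (F \o y) t - u k.+1 t)
       (df := df)) => [|s||s].
    - by rewrite !mulr_ge0.
    - have ? := picard_map_derive p (uc k) s.
      by have ? := picard_map_derive p yc s; apply: is_derive_eq.
    - by rewrite picard_map0// u0 subrr.
    - apply: le_trans (FL _ _) _; rewrite mulrAC mulrC ler_wpM2r ?(ltW L0)//.
  have := yu k.+1 t; rewrite distrC exprSr => yuk.
  rewrite -(subrKA (u k.+1 t)); apply: le_trans (ler_normD _ _) _.
  by lra.
split; first by rewrite -zE picard_map0.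
move=> t; have := picard_map_derive p yc t.
by have -> : (fun t => p + primitive (F \o y) t) = y by exact/funext.
Qed.

End PicardLindelof.

(** * The cross product of R^7 *)

Section CrossProduct.
Context {R : realType}.
Local Notation V := 'rV[R]_7.
Implicit Types u v w p : V.

Lemma big_ord7 (F : 'I_7 -> R) : \sum_(i < 7) F i =
  F (inord 0) + (F (inord 1) + (F (inord 2) + (F (inord 3) +
  (F (inord 4) + (F (inord 5) + F (inord 6)))))).
Proof.
by rewrite !big_ord_recl big_ord0 addr0; repeat (congr (_ + _));
  congr (F _); apply: val_inj; rewrite /= inordK.
Qed.

Lemma oct_of_im0 u : oct_of_im u 0 ord0 = 0.
Proof.
have -> : oct_of_im u 0 ord0 = row_mx (0 : 'rV[R]_1) u 0 (lshift 7 (ord0 : 'I_1)).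
  by congr (row_mx _ _ _ _); exact: val_inj.
by rewrite row_mxEl mxE.
Qed.

Lemma oct_of_imS u i : oct_of_im u 0 (lift ord0 i) = u 0 i.
Proof.
have -> : oct_of_im u 0 (lift ord0 i) = row_mx (0 : 'rV[R]_1) u 0 (rshift 1 i).
  by congr (row_mx _ _ _ _); exact: val_inj.
by rewrite row_mxEr.
Qed.

Lemma oct_mul_im u v (k : 'I_7) :
  im_of_oct (oct_mul (oct_of_im u) (oct_of_im v)) 0 k =
  \sum_(i < 7) \sum_(j < 7) u 0 i * v 0 j * oct_eps i.+1 j.+1 k.+1.
Proof.
rewrite /im_of_oct mxE /oct_mul summxE big_ord_recl.
rewrite summxE big1 ?add0r => [|j _]; last first.
  by rewrite mxE oct_of_im0 !mul0r.
apply: eq_bigr => i _; rewrite summxE big_ord_recl mxE oct_of_im0 mulr0 mul0r.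
rewrite add0r; apply: eq_bigr => j _; rewrite mxE !oct_of_imS; congr (_ * _).
rewrite /oct_mul_basis !mxE summxE mulr0 add0r.
rewrite (bigD1 (rshift 1 k))//= big1 => [|l /andP[_ /negbTE lk]].
  by rewrite !mxE !eqxx mulr1 addr0.
by rewrite !mxE eq_sym lk mulr0.
Qed.

Lemma cross_coord u v (k : 'I_7) : cross u v 0 k =
  2^-1 * (\sum_(i < 7) \sum_(j < 7) u 0 i * v 0 j * oct_eps i.+1 j.+1 k.+1 -
          \sum_(i < 7) \sum_(j < 7) v 0 i * u 0 j * oct_eps i.+1 j.+1 k.+1).
Proof. by rewrite -!oct_mul_im /cross /im_of_oct !mxE. Qed.

(** The entry k collects the pairs (i, j) for which (i, j, k) is, up to a
    cyclic permutation, one of the seven triples of the multiplication table,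
    with indices starting from 0. *)
Lemma crossE u v : cross u v = \row_(k < 7)
  (let m i j := u 0 (inord i) * v 0 (inord j) - u 0 (inord j) * v 0 (inord i) in
   nth 0
    [:: m 1%N 2%N + m 3%N 4%N + m 5%N 6%N;
       m 2%N 0%N + m 3%N 5%N + m 6%N 4%N;
       m 0%N 1%N + m 6%N 3%N + m 5%N 4%N;
       m 4%N 0%N + m 5%N 1%N + m 2%N 6%N;
       m 0%N 3%N + m 1%N 6%N + m 2%N 5%N;
       m 6%N 0%N + m 1%N 3%N + m 4%N 2%N;
       m 0%N 5%N + m 4%N 1%N + m 3%N 2%N] k).
Proof.
apply/rowP => k; rewrite cross_coord mxE !big_ord7 !inordK//.
by case: k => [[|[|[|[|[|[|[|//]]]]]]] ?]; rewrite /oct_eps /=; field.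
Qed.

Lemma dotE u v : dot u v = 
  u 0 (inord 0) * v 0 (inord 0) + (u 0 (inord 1) * v 0 (inord 1) +
  (u 0 (inord 2) * v 0 (inord 2) + (u 0 (inord 3) * v 0 (inord 3) +
  (u 0 (inord 4) * v 0 (inord 4) + (u 0 (inord 5) * v 0 (inord 5) +
   u 0 (inord 6) * v 0 (inord 6)))))).
Proof. by rewrite /dot big_ord7. Qed.

Lemma cross_anticomm u v : cross u v = - cross v u.
Proof.
apply/rowP => k; rewrite !crossE !mxE.
by case: k => [[|[|[|[|[|[|[|//]]]]]]] ?] /=; ring.
Qed.

Lemma dot_crossl u v : dot u (cross u v) = 0.
Proof. by rewrite dotE crossE !mxE !inordK//=; ring. Qed.

Lemma row7P u v :
  (forall k : nat, (k < 7)%N -> u 0 (inord k) = v 0 (inord k)) -> u = v.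
Proof. by move=> uv; apply/rowP => k; rewrite -[k]inord_val uv. Qed.

(** This double product formula holds although the cross product of R^7
    satisfies no Jacobi identity: it expresses the alternativity of the
    octonions. *)
Lemma cross_crossl p u : cross p (cross p u) = dot p u *: p - dot p p *: u.
Proof.
apply: row7P => -[|[|[|[|[|[|[|//]]]]]]] _;
  by rewrite crossE mxE inordK//= crossE !dotE !mxE !inordK//=; ring.
Qed.

Lemma dotC u v : dot u v = dot v u.
Proof. by apply: eq_bigr => i _; rewrite mulrC. Qed.

Lemma dotDr u v w : dot u (v + w) = dot u v + dot u w.
Proof. by rewrite /dot -big_split; apply: eq_bigr => i _; rewrite mxE mulrDr. Qed.

Lemma dotZr (a : R) u v : dot u (a *: v) = a * dot u v.
Proof. by rewrite /dot mulr_sumr; apply: eq_bigr => i _; rewrite mxE mulrCA. Qed.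

Lemma dot0r u : dot u 0 = 0.
Proof. by rewrite -(scale0r 0) dotZr mul0r. Qed.

Lemma dot_ge0 u : 0 <= dot u u.
Proof. by apply: sumr_ge0 => i _; rewrite -expr2 sqr_ge0. Qed.

Lemma dot_gt0 u : (0 < dot u u) = (u != 0).
Proof.
rewrite lt_neqAle dot_ge0 andbT eq_sym; congr (~~ _); apply/eqP/eqP => [u0|->].
  apply/rowP => i; rewrite mxE; apply/eqP; rewrite -sqrf_eq0 expr2.
  have := u0; rewrite /dot => /eqP; rewrite psumr_eq0 => [/allP/(_ i)|j _].
    by rewrite mem_index_enum => /(_ isT).
  by rewrite -expr2 sqr_ge0.
by rewrite dot0r.
Qed.

Lemma crossDr p u v : cross p (u + v) = cross p u + cross p v.
Proof.
apply: row7P => -[|[|[|[|[|[|[|//]]]]]]] _;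
  by rewrite !crossE !mxE !inordK//= !mxE; ring.
Qed.

Lemma crossZr p a u : cross p (a *: u) = a *: cross p u.
Proof.
apply: row7P => -[|[|[|[|[|[|[|//]]]]]]] _;
  by rewrite !crossE !mxE !inordK//= !mxE; ring.
Qed.

Lemma cross0r p : cross p 0 = 0.
Proof. by rewrite -[X in cross _ X](scale0r 0) crossZr scale0r. Qed.

Lemma dot_crossr p u : dot u (cross p u) = 0.
Proof. by rewrite cross_anticomm -scaleN1r dotZr dot_crossl mulr0. Qed.

Lemma dot_cross_cycle u v w : dot (cross u v) w = dot u (cross v w).
Proof. by rewrite !dotE !crossE !mxE !inordK//=; ring. Qed.

Lemma Jstr_sqr p u : S6 p -> TS6 p u -> Jstr p (Jstr p u) = - u.
Proof.
by rewrite /S6 /TS6/= /Jstr cross_crossl => -> ->; rewrite scale0r scale1r sub0r.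
Qed.

Lemma cross_crossr p u : cross u (cross p u) = dot u u *: p - dot u p *: u.
Proof. by rewrite (cross_anticomm p) -scaleN1r crossZr cross_crossl scaleN1r opprB. Qed.

Lemma Ck_cross (W : normedModType R) k (U : set W) (f g : W -> V) : open U ->
  Ck k U f -> Ck k U g -> Ck k U (fun x => cross (f x) (g x)).
Proof.
move=> oU fk gk; apply: Ck_row => // l.
have bil (f' g' : W -> V) : Ck k U f' -> Ck k U g' -> Ck k U (fun x =>
    \sum_(i < 7) \sum_(j < 7) f' x 0 i * g' x 0 j * oct_eps i.+1 j.+1 l.+1).
  move=> fk' gk'; apply: Ck_sum => // i; apply: Ck_sum => // j.
  apply: CkM => //; last exact: Ck_cst.
  by apply: CkM => //; apply: Ck_coord.
have -> : (fun x => cross (f x) (g x) 0 l) = (fun x => 2^-1 *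
  (\sum_(i < 7) \sum_(j < 7) f x 0 i * g x 0 j * oct_eps i.+1 j.+1 l.+1 +
   -1 * \sum_(i < 7) \sum_(j < 7) g x 0 i * f x 0 j * oct_eps i.+1 j.+1 l.+1)).
  by apply/funext => x; rewrite cross_coord mulN1r.
apply: CkM => //; first exact: Ck_cst.
apply: CkD => //; first exact: bil.
by apply: CkM => //; [exact: Ck_cst|exact: bil].
Qed.

Lemma Ck_dot (W : normedModType R) k (U : set W) (f g : W -> V) : open U ->
  Ck k U f -> Ck k U g -> Ck k U (fun x : W => dot (f x) (g x)).
Proof.
move=> oU fk gk; apply: Ck_sum => // i; apply: CkM => //; exact: Ck_coord.
Qed.

End CrossProduct.

(** * Uniform Taylor estimates on a compact set *)

Section TaylorOnCompact.
Context {R : realType} {n : nat}.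
Local Notation V := 'rV[R]_n.
Implicit Types (f : V -> R) (U K : set V) (a b p x v : V).

(** A bound that holds locally on a compact set, and stays true when its
    constant is increased, holds with one constant. *)
Lemma compact_bound (P : R -> V -> Prop) K : compact K ->
  (forall p, K p -> exists rho M : R, 0 < rho /\
     forall N x, M <= N -> K x -> `|p - x| < rho -> P N x) ->
  exists M : R, 0 <= M /\ forall x, K x -> P M x.
Proof.
move=> /compact_near_coveringP/near_covering_withinP cK Ploc.
have /(_ _)[|M [Mr HM]] := cK R +oo P _.
  move=> p Kp; have [rho [M [rho0 HM]]] := Ploc p Kp.
  have np : \forall x \near p, `|p - x| < rho.
    by have /cvgrPdist_lt := @cvg_id _ (nbhs p); apply.
  have nM : \forall N \near +oo, M <= N by exact: nbhs_pinfty_ge (num_real _).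
  exists ([set x | `|p - x| < rho], [set N | M <= N]) => //= -[x N] /= [px MN] Kx.
  exact: HM.
exists (Num.max (M + 1) 0); split; first by rewrite le_max lexx orbT.
by apply: HM; rewrite lt_max ltrDl ltr01.
Qed.

Lemma continuous_compact_bound f K : compact K ->
  (forall x, K x -> {for x, continuous f}) ->
  exists M : R, 0 <= M /\ forall x, K x -> `|f x| <= M.
Proof.
move=> cK fc; apply: (@compact_bound (fun M x => `|f x| <= M)) cK _ => p Kp.
have /cvgrPdist_lt/(_ 1 ltr01) := fc p Kp.
move=> /nbhs_normP[rho /= rho0 Hrho]; exists rho, (`|f p| + 1); split => // N x MN _.
move=> /Hrho /= fpx; apply: le_trans MN; rewrite -lerBlDl.
by rewrite (le_trans (lerB_dist _ _))// distrC ltW.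
Qed.

Lemma segment_mean_value f a b :
  (forall t : R, 0 <= t <= 1 -> differentiable f (a + t *: (b - a))) ->
  exists2 t : R, 0 <= t <= 1 & f b - f a = 'D_(b - a) f (a + t *: (b - a)).
Proof.
move=> fd; pose c (t : R) : V := a + t *: (b - a).
have cd (t : R) : is_derive t 1 c (b - a).
  have ? : is_derive t 1 (fun t : R => t *: (b - a)) (b - a).
    apply: is_derive_row => j; rewrite (_ : (fun y => _) = (fun y : R => y * (b - a) 0 j)).
      by apply: is_derive_eq; rewrite scaler0 add0r [_ *: _]mulr1.
    by apply/funext => y; rewrite mxE.
  by apply: is_derive_eq; rewrite add0r.
have fcd (t : R) : 0 <= t <= 1 -> is_derive t 1 (f \o c) ('D_(b - a) f (c t)).
  by move=> t01; apply: is_derive_comp_curve => //; exact: fd.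
have [x||t t01] :=
  @MVT_segment R (f \o c) (fun t => 'D_(b - a) f (c t)) 0 1 ler01.
- by rewrite in_itv/= => /andP[x0 x1]; apply: fcd; rewrite !ltW.
- apply: derivable_within_continuous => x; rewrite in_itv/= => x01.
  by have [] := fcd x x01.
rewrite /= /c subr0 mulr1 scale0r addr0 scale1r subrKC => E.
by exists t => //; move: t01; rewrite in_itv.
Qed.

Lemma ball_segment p a b (rho t : R) : `|p - a| < rho -> `|p - b| < rho ->
  0 <= t <= 1 -> `|p - (a + t *: (b - a))| < rho.
Proof.
move=> pa pb /andP[t0 t1].
have -> : p - (a + t *: (b - a)) = (1 - t) *: (p - a) + t *: (p - b).
  by apply/rowP => j; rewrite !mxE; ring.
apply: le_lt_trans (ler_normD _ _) _; rewrite !normrZ ger0_norm ?subr_ge0//.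
rewrite (ger0_norm t0).
have [->|tn0] := eqVneq t 0; first by rewrite subr0 mul1r mul0r addr0.
have tp : 0 < t by rewrite lt_neqAle eq_sym tn0.
have H1 : (1 - t) * `|p - a| <= (1 - t) * rho.
  by rewrite ler_wpM2l ?subr_ge0// ltW.
have H2 : t * `|p - b| < t * rho by rewrite ltr_pM2l.
by lra.
Qed.

Lemma derive_norm_le f x v (M : R) : differentiable f x ->
  (forall j : 'I_n, `|'D_(delta_mx 0 j) f x| <= M) ->
  `|'D_v f x| <= n%:R * (M * `|v|).
Proof.
move=> fd fM; rewrite derive_lincomb//.
apply: le_trans (ler_norm_sum _ _ _) _; apply: sum_le_const => j.
rewrite normrM mulrC ler_pM//; exact: normr_coord_le.
Qed.

Lemma C1_locally_lipschitz U f p : open U -> U p -> Ck 1 U f ->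
  exists rho L : R, [/\ 0 < rho, 0 <= L, (forall x, `|p - x| < rho -> U x) &
    forall a b, `|p - a| < rho -> `|p - b| < rho ->
      `|f b - f a| <= L * `|b - a|].
Proof.
move=> oU Up [fd fD].
have /nbhs_normP[r1 /= r10 Hr1] : nbhs p U by exact: open_nbhs_nbhs.
have nD : \forall x \near p, forall j : 'I_n,
    `|'D_(delta_mx 0 j) f p - 'D_(delta_mx 0 j) f x| < 1.
  apply: (@filter_forall _ _ _ (nbhs p)) => j; have := fD (delta_mx 0 j) p Up.
  by move=> /cvgrPdist_lt/(_ 1 ltr01).
have /nbhs_normP[r2 /= r20 Hr2] := nD.
pose M : R := \sum_(j < n) `|'D_(delta_mx 0 j) f p| + 1.
have M0 : 0 <= M by rewrite addr_ge0// sumr_ge0.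
exists (Num.min r1 r2), (n%:R * M); split.
- by rewrite lt_min r10.
- by rewrite mulr_ge0.
- by move=> x; rewrite lt_min => /andP[/Hr1].
move=> a b pa pb.
have inU (t : R) : 0 <= t <= 1 -> `|p - (a + t *: (b - a))| < Num.min r1 r2.
  exact: ball_segment.
have [t /inU|t t01 ->] := @segment_mean_value f a b.
  by rewrite lt_min => /andP[/Hr1 /fd].
have := inU t t01; rewrite lt_min => /andP[/Hr1 /fd fdt /Hr2 Dt].
rewrite -mulrA; apply: derive_norm_le => // j; have /= := Dt j.
move=> /ltW H; have := lerB_dist ('D_(delta_mx 0 j) f (a + t *: (b - a)))
  ('D_(delta_mx 0 j) f p).
rewrite distrC => H2; have := le_trans H2 H; rewrite lerBlDl => H3.
apply: le_trans H3 _; rewrite /M lerD2r (bigD1 j)//= lerDl.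
by apply: sumr_ge0.
Qed.

(** By the mean value theorem the remainder is the variation of the first
    derivatives along the segment, applied to b - a; these are locally
    Lipschitz. *)
Lemma C2_local_taylor U f p : open U -> U p -> Ck 2 U f ->
  exists rho L : R, [/\ 0 < rho, 0 <= L &
    forall a b, `|p - a| < rho -> `|p - b| < rho ->
      `|f b - f a - 'D_(b - a) f a| <= L * `|b - a| ^+ 2].
Proof.
move=> oU Up [fd fD].
have lipD (j : 'I_n) := C1_locally_lipschitz oU Up (fD (delta_mx 0 j)).
have /nbhs_normP[r1 /= r10 Hr1] : nbhs p U by exact: open_nbhs_nbhs.
pose r j := sval (cid (lipD j)); pose lip j := svalP (cid (lipD j)).
pose l j := sval (cid (lip j)); pose lP j := svalP (cid (lip j)).
pose rho := \big[Order.min/r1]_j r j; pose L := \sum_j l j.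
have l0 j : 0 <= l j by case: (lP j).
have L0 : 0 <= L by apply: sumr_ge0.
exists rho, (n%:R * L); split.
- by apply: lt_bigmin => // j _; case: (lP j).
- by rewrite mulr_ge0.
move=> a b pa pb.
have inU (t : R) : 0 <= t <= 1 -> `|p - (a + t *: (b - a))| < rho.
  exact: ball_segment.
have rU x : `|p - x| < rho -> U x.
  by move=> px; apply: Hr1; apply: lt_le_trans px _; exact: bigmin_le_id.
have [t /inU/rU/fd//|t t01 ->] := @segment_mean_value f a b.
set x := a + _; have xa : `|x - a| <= `|b - a|.
  rewrite /x addrC addKr normrZ ler_piMl//; case/andP: t01 => t0 t1.
  by rewrite ger0_norm.
have px := inU t t01; rewrite -/x in px.
rewrite (derive_lincomb _ (fd _ (rU _ px))) (derive_lincomb _ (fd _ (rU _ pa))).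
rewrite -sumrB; apply: le_trans (ler_norm_sum _ _ _) _.
rewrite -mulrA; apply: sum_le_const => j.
rewrite -scalerBr normrM expr2 [leRHS]mulrCA ler_pM//; first exact: normr_coord_le.
have rj y : `|p - y| < rho -> `|p - y| < r j.
  by move=> py; apply: lt_le_trans py _; exact: bigmin_le.
have [_ _ _ H] := lP j; apply: le_trans (H _ _ (rj _ pa) (rj _ px)) _.
apply: ler_pM => //; first exact: l0.
by rewrite /L (bigD1 j)//= lerDl; exact: sumr_ge0.
Qed.

(** K is not convex, so the local estimate only serves pairs of nearby points.
    For points at distance at least rho / 2 the left-hand side is bounded, by
    compactness, and the square of the distance is bounded below. *)
Lemma compact_taylor U K f : open U -> compact K -> K `<=` U -> Ck 2 U f ->
  exists M : R, 0 <= M /\ forall a, K a -> forall b, K b ->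
    `|f b - f a - 'D_(b - a) f a| <= M * `|b - a| ^+ 2.
Proof.
move=> oU cK KU f2; have [fd fD] := f2.
have [B [B0 fB]] : exists M : R, 0 <= M /\ forall x, K x -> `|f x| <= M.
  by apply: continuous_compact_bound => // x /KU /fd/differentiable_continuous.
have DB j : exists M : R, 0 <= M /\
    forall x, K x -> `|'D_(delta_mx 0 j) f x| <= M.
  apply: continuous_compact_bound => // x /KU Ux.
  by have [/(_ x Ux)/differentiable_continuous] := fD (delta_mx 0 j).
pose C j := sval (cid (DB j)); pose CP j := svalP (cid (DB j)).
pose D := \sum_j C j.
have D0 : 0 <= D by apply: sumr_ge0 => j _; exact: (CP j).1.
have fDv x v : K x -> `|'D_v f x| <= n%:R * (D * `|v|).
  move=> Kx; apply: derive_norm_le => [|j]; first exact/fd/KU.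
  apply: le_trans ((CP j).2 x Kx) _.
  by rewrite /D (bigD1 j)//= lerDl; apply: sumr_ge0 => i _; exact: (CP i).1.
apply: (@compact_bound (fun M a => forall b, K b ->
    `|f b - f a - 'D_(b - a) f a| <= M * `|b - a| ^+ 2)) cK _ => p Kp.
have [rho [L [rho0 L0 taylor]]] := C2_local_taylor oU (KU _ Kp) f2.
have r20 : 0 < rho / 2 by rewrite divr_gt0.
(* for |b - x| >= rho / 2 the remainder is at most
   2 B + n D |b - x| <= far |b - x|^2 *)
pose far := 2 * B / (rho / 2) ^+ 2 + n%:R * D / (rho / 2).
exists (rho / 2), (Num.max L far); split=> // N x; rewrite ge_max.
move=> /andP[LN farN] Kx px b Kb.
have px' : `|p - x| < rho.
  by apply: lt_le_trans px _; rewrite ler_pdivrMr// ler_peMr ?ler1n// ltW.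
have [pb|pb] := ltP `|p - b| rho.
  by apply: le_trans (taylor _ _ px' pb) _; rewrite ler_wpM2r// exprn_ge0.
have bx : rho / 2 <= `|b - x|.
  have := ler_distD x p b; rewrite (distrC x b) => H.
  by have := le_trans pb H; move: px; lra.
apply: le_trans (ler_normB _ _) _.
apply: le_trans (lerD (ler_normB _ _) (fDv _ _ Kx)) _.
have F1 := fB _ Kb; have F2 := fB _ Kx.
set d := `|b - x| in bx *.
have d0 : 0 <= d by exact: normr_ge0.
apply: (@le_trans _ _ (far * d ^+ 2)); last by rewrite ler_wpM2r// exprn_ge0.
rewrite /far mulrDl; apply: lerD.
  apply: (@le_trans _ _ (2 * B)); first by lra.
  rewrite mulrAC ler_pdivlMr ?exprn_gt0// ler_wpM2l ?mulr_ge0//.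
  by rewrite lerXn2r ?nnegrE// ltW.
rewrite [leRHS]mulrAC ler_pdivlMr// -!mulrA ler_wpM2l// ler_wpM2l//.
by rewrite expr2 ler_wpM2l.
Qed.

End TaylorOnCompact.

(** * Smooth extension of fields off the sphere *)

Section SphereExtension.
Context {R : realType}.
Local Notation V := 'rV[R]_7.
Implicit Types (x v p : V).

Definition punctured : set V := [set x | x != 0].

Lemma open_punctured : open punctured.
Proof.
have -> : punctured = ~` [set 0].
  by apply/seteqP; split => x /=; move/eqP.
exact/closed_openC/accessible_closed_set1/hausdorff_accessible/norm_hausdorff.
Qed.

Definition inv_norm x : R := (Num.sqrt (dot x x))^-1.

Lemma differentiable_dot x : differentiable (fun x : V => dot x x) x.
Proof.
have [+ _] : Ck 1 setT (fun x : V => dot x x).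
  by apply: Ck_dot; [exact: openT|exact: Ck_id|exact: Ck_id].
exact.
Qed.

Lemma derive_dot x v : 'D_v (fun x : V => dot x x) x = 2 * dot x v.
Proof.
have cd i : is_derive x v (fun x : V => x 0 i) (v 0 i).
  exact: is_derive_coord (is_derive_id x v).
have md i : is_derive x v (fun x : V => x 0 i * x 0 i) (2 * (x 0 i * v 0 i)).
  by have ? := cd i; apply: is_derive_eq; rewrite /GRing.scale/=; ring.
have [_] := @is_derive_sum _ _ _ _ (fun (i : 'I_7) x => x 0 i * x 0 i) x v _ md.
rewrite -mulr_sumr => <-; congr ('D_v _ x).
by apply/funext => y; rewrite fct_sumE.
Qed.

Lemma differentiable_inv_norm x : x != 0 -> differentiable inv_norm x.
Proof.
rewrite -dot_gt0 => x0; apply: (@differentiable_comp _ _ _ _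
  (fun x : V => dot x x) (fun t => (Num.sqrt t)^-1)).
  exact: differentiable_dot.
apply/derivable1_diffP; have ? := is_derive1_sqrt x0.
by apply: derivableV; rewrite // gt_eqF// sqrtr_gt0.
Qed.

(** The derivative of 1 / |x| is polynomial in 1 / |x| and x, so smoothness
    follows by induction without differentiating a square root again. *)
Lemma derive_inv_norm x v : x != 0 ->
  'D_v inv_norm x = - 1 * (inv_norm x * (inv_norm x * inv_norm x)) * dot x v.
Proof.
move=> x0; have x0' := x0; rewrite -dot_gt0 in x0'.
have s0 : Num.sqrt (dot x x) != 0 by rewrite gt_eqF// sqrtr_gt0.
have gd : is_derive (dot x x) 1 (fun t => (Num.sqrt t)^-1)
   (- (Num.sqrt (dot x x)) ^- 2 *: (2 * Num.sqrt (dot x x))^-1).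
  by have ? := is_derive1_sqrt x0'; exact: is_deriveV.
have [gdd gde] := gd; have gdiff := (derivable1_diffP _ _).1 gdd.
have := @derive_comp R _ _ _ (fun t : R => (Num.sqrt t)^-1) (fun x : V => dot x x)
  x v (differentiable_dot x) gdiff.
rewrite derive_dot derive_real_dir// gde /inv_norm => ->.
by rewrite /GRing.scale/=; field.
Qed.

Lemma smooth_inv_norm : smooth_on punctured inv_norm.
Proof.
elim=> [|k IH].
  by move=> x x0; exact/differentiable_continuous/differentiable_inv_norm.
split=> [x|v]; first exact: differentiable_inv_norm.
have oP := open_punctured.
have : Ck k punctured (fun x => - 1 *
    (inv_norm x * (inv_norm x * inv_norm x)) * dot x v).
  apply: CkM => //; first apply: CkM => //; first exact: Ck_cst.
    by apply: CkM => //; apply: CkM.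
  by apply: Ck_dot => //; [exact: Ck_id|exact: Ck_cst].
by apply: Ck_eq => // x /set_mem x0; rewrite derive_inv_norm.
Qed.

Lemma smooth_normalize : smooth_on punctured (@normalize R).
Proof.
move=> k; apply: CkZr; first exact: open_punctured.
  exact: smooth_inv_norm.
exact: Ck_id.
Qed.

Lemma S6_neq0 p : S6 p -> punctured p.
Proof. by rewrite /S6 /punctured/= -dot_gt0 => ->. Qed.

Lemma normalize_S6 p : S6 p -> normalize p = p.
Proof. by rewrite /normalize /S6 /= => ->; rewrite sqrtr1 invr1 scale1r. Qed.

Lemma S6_normalize x : punctured x -> S6 (normalize x).
Proof.
rewrite /punctured/= -dot_gt0 => x0; rewrite /S6 /normalize/= dotZr dotC dotZr.
rewrite mulrA -expr2 exprVn sqr_sqrtr ?ltW// mulVf ?gt_eqF//.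
Qed.

(** Near x the composite is G o normalize, with G a local smooth extension of
    F around x / |x|. *)
Lemma smooth_extension (F : V -> V) :
  smooth_S6 F -> smooth_on punctured (F \o @normalize R).
Proof.
move=> Fs k; have oP := open_punctured; apply: Ck_local => x x0.
have [U [G [oU Un Gs GF]]] := Fs _ (S6_normalize x0).
have nc y : punctured y -> {for y, continuous (@normalize R)}.
  exact: (smooth_normalize 0).
exists (punctured `&` @normalize R @^-1` U).
have oI : open (punctured `&` @normalize R @^-1` U).
  rewrite openE => y [y0 Uy]; apply: filterI; first exact: open_nbhs_nbhs.
  exact: (nc y y0 U (open_nbhs_nbhs (conj oU Uy))).
split=> //; apply: (@Ck_eq _ _ _ _ _ (G \o @normalize R)) => //.
  by move=> y /set_mem [y0 Uy] /=; rewrite GF//; exact: S6_normalize.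
apply: (Ck_comp (U' := U)) => //; first by move=> y [].
apply: Ck_sub (smooth_normalize k); exact: subIsetl.
Qed.

Lemma smooth_S6_cross (F G : V -> V) : smooth_S6 F -> smooth_S6 G ->
  smooth_S6 (fun x => cross (F x) (G x)).
Proof.
move=> Fs Gs p Sp; have [U [f [oU Up fs fF]]] := Fs p Sp.
have [U' [g [oU' Up' gs gG]]] := Gs p Sp.
exists (U `&` U'), (fun x => cross (f x) (g x)); split => //.
- exact: openI.
- move=> k; apply: Ck_cross; first exact: openI.
  + by apply: Ck_sub (fs k); exact: subIsetl.
  + by apply: Ck_sub (gs k); exact: subIsetr.
- by move=> x [Ux Ux'] Sx; rewrite fF// gG.
Qed.

Lemma vector_field_Jfield (X : V -> V) : vector_field X -> vector_field (Jfield X).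
Proof.
move=> [Xs XT]; split; last first.
  by move=> p Sp; rewrite /TS6/= /Jfield /Jstr dot_crossl.
apply: smooth_S6_cross => // p Sp; exists setT, id; split => //.
  exact: openT.
by move=> k; exact: Ck_id.
Qed.

Lemma S6_coord_le p j : S6 p -> `|p 0 j| <= 1.
Proof.
rewrite /S6/= /dot => p1; rewrite -(@ler_pXn2r _ 2)// ?nnegrE// expr1n.
rewrite -p1 (bigD1 j)//= -expr2 real_normK ?num_real// lerDl.
by apply: sumr_ge0 => i _; rewrite -expr2 sqr_ge0.
Qed.

Lemma S6_norm_le p : S6 p -> `|p| <= 1.
Proof. by move=> Sp; apply: normr_row_le => // j; exact: S6_coord_le. Qed.

Lemma compact_S6 : compact (@S6 R).
Proof.
apply: bounded_closed_compact.
  exists 1; split; first exact: num_real.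
  by move=> M M1 p Sp; apply: le_trans (S6_norm_le Sp) (ltW M1).
apply: (@closed_comp _ _ (fun x : V => dot x x) [set 1]); last exact: closed_eq.
by move=> x _; exact/differentiable_continuous/differentiable_dot.
Qed.

End SphereExtension.

(** * Estimates for a vector field on the sphere *)

Section QuadraticRemainder.
Context {R : realType}.

(** A remainder that is at most quadratic identifies the differential. *)
Lemma quadratic_is_diff (V W : normedModType R) (f : V -> W) x
    (l : V -> W) (C : R) : linear l -> continuous l ->
  (forall h, `|f (h + x) - f x - l h| <= C * `|h| ^+ 2) -> is_diff x f l.
Proof.
move=> l_lin lc fC.
pose lM := GRing.isLinear.Build _ _ _ _ _ l_lin.
pose lL : {linear V -> W} := HB.pack l lM.
apply: (@differentiable_bound R V W f x lL) => // e e0.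
pose D := `|C| + 1.
have D0 : 0 < D by rewrite ltr_wpDl.
have : \forall h \near (0 : V), `|0 - h| < e / D.
  by have /cvgrPdist_lt := @cvg_id _ (nbhs (0 : V)); apply; rewrite divr_gt0.
apply: filterS => h; rewrite sub0r normrN => hD; apply: le_trans (fC h) _.
rewrite expr2 mulrA ler_wpM2r//; apply: (@le_trans _ _ (D * `|h|)).
  by rewrite ler_wpM2r// /D (le_trans (ler_norm _))// lerDl.
by rewrite -ler_pdivlMl// mulrC ltW.
Qed.

Lemma quadratic_is_derive (W : normedModType R) (f : R -> W) (x : R) (d : W)
    (C : R) :
  (forall h, `|f (h + x) - f x - h *: d| <= C * h ^+ 2) -> is_derive x 1 f d.
Proof.
move=> fC.
have lc : continuous ( *:%R^~ d : R -> W) by exact: scalel_continuous.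
have D : is_diff x f ( *:%R^~ d).
  apply: (quadratic_is_diff (C := C)) => // [u y z|h].
    by rewrite scalerDl scalerA.
  by rewrite real_normK ?num_real.
have [fd df] := D; have fd1 := (derivable1_diffP _ _).2 fd.
by apply: DeriveDef => //; rewrite -diff_derive// df scale1r.
Qed.

End QuadraticRemainder.

Section SphereVectorField.
Context {R : realType}.
Local Notation V := 'rV[R]_7.
Variable Z : V -> V.
Hypothesis Zvf : vector_field Z.
Local Notation Zext := (Z \o @normalize R).

Let Zext_smooth : smooth_on punctured Zext.
Proof. by apply: smooth_extension; case: Zvf. Qed.

Lemma vector_field_extE p : S6 p -> Zext p = Z p.
Proof. by move=> Sp /=; rewrite normalize_S6. Qed.

Lemma differentiable_ext p : S6 p -> differentiable Zext p.
Proof. by move=> /S6_neq0; have [+ _] := Zext_smooth 1; exact. Qed.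

Lemma vector_field_bound : exists B : R, 0 <= B /\ forall p, S6 p -> `|Z p| <= B.
Proof.
have bj (j : 'I_7) : exists B : R, 0 <= B /\
    forall p, S6 p -> `|Zext p 0 j| <= B.
  apply: continuous_compact_bound; first exact: compact_S6.
  move=> p /S6_neq0; apply: (Ck_coord j open_punctured (Zext_smooth 0)).
pose B j := sval (cid (bj j)); pose BP j := svalP (cid (bj j)).
have B0 j : 0 <= B j by case: (BP j).
exists (\sum_j B j); split; first exact: sumr_ge0.
move=> p Sp; apply: normr_row_le => [|j]; first exact: sumr_ge0.
have := (BP j).2 p Sp; rewrite vector_field_extE// => /le_trans; apply.
by rewrite (bigD1 j)//= lerDl; exact: sumr_ge0.
Qed.

Lemma vector_field_derive_bound : exists D : R, 0 <= D /\
  forall p v, S6 p -> `|'D_v Zext p| <= D * `|v|.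
Proof.
have bij (i j : 'I_7) : exists B : R, 0 <= B /\
    forall p, S6 p -> `|'D_(delta_mx 0 i) (fun x => Zext x 0 j) p| <= B.
  apply: continuous_compact_bound; first exact: compact_S6.
  have [_ D] := Ck_coord j open_punctured (Zext_smooth 1).
  by move=> p /S6_neq0; exact: (D (delta_mx 0 i)).
pose B i j := sval (cid (bij i j)); pose BP i j := svalP (cid (bij i j)).
have B0 i j : 0 <= B i j by case: (BP i j).
pose D := \sum_i \sum_j B i j.
have D0 : 0 <= D by apply: sumr_ge0 => i _; exact: sumr_ge0.
have BD i j : B i j <= D.
  rewrite /D (bigD1 i)//= (bigD1 j)//= -addrA lerDl addr_ge0//.
    exact: sumr_ge0.
  by apply: sumr_ge0 => k _; exact: sumr_ge0.
exists (7%:R * D); split; first by rewrite mulr_ge0.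
move=> p v Sp; apply: normr_row_le => [|j]; first by rewrite !mulr_ge0.
have Zd := differentiable_ext Sp.
rewrite -derive_coord; last exact: diff_derivable.
rewrite -mulrA; apply: derive_norm_le; first exact: differentiable_rowP.
by move=> i; apply: le_trans ((BP i j).2 p Sp) (BD i j).
Qed.

Lemma vector_field_taylor : exists M : R, 0 <= M /\
  forall a b, S6 a -> S6 b -> `|Z b - Z a - 'D_(b - a) Zext a| <= M * `|b - a| ^+ 2.
Proof.
have tj j := compact_taylor open_punctured compact_S6 (@S6_neq0 R)
  (Ck_coord j open_punctured (Zext_smooth 2)).
pose M j := sval (cid (tj j)); pose MP j := svalP (cid (tj j)).
have M0 j : 0 <= M j by case: (MP j).
exists (\sum_j M j); split; first exact: sumr_ge0.
move=> a b Sa Sb; apply: normr_row_le => [|j].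
  by rewrite mulr_ge0 ?exprn_ge0// sumr_ge0.
have := (MP j).2 a Sa b Sb; rewrite !vector_field_extE// derive_coord; last first.
  exact/diff_derivable/differentiable_ext.
rewrite !mxE => /le_trans; apply; rewrite ler_wpM2r ?exprn_ge0//.
by rewrite (bigD1 j)//= lerDl; exact: sumr_ge0.
Qed.

(** The derivative of the extension is bounded on the sphere, and two points
    of the sphere are at distance at most 2, so the quadratic Taylor remainder
    is also controlled linearly. *)
Lemma vector_field_lipschitz : exists L : R, 0 < L /\
  forall a b, S6 a -> S6 b -> `|Z a - Z b| <= L * `|a - b|.
Proof.
have [D [D0 ZD]] := vector_field_derive_bound.
have [M [M0 ZM]] := vector_field_taylor.
exists (D + M * 2 + 1); split; first by rewrite ltr_wpDl ?addr_ge0 ?mulr_ge0.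
move=> a b Sa Sb; rewrite distrC (distrC a).
rewrite -(subrK ('D_(b - a) Zext a) (Z b - Z a)).
apply: le_trans (ler_normD _ _) _.
apply: le_trans (lerD (ZM a b Sa Sb) (ZD a (b - a) Sa)) _.
have ba : `|b - a| <= 2.
  have := ler_normB b a; have := S6_norm_le Sa; have := S6_norm_le Sb; lra.
set d := `|b - a| in ba *; have d0 : 0 <= d by exact: normr_ge0.
have : 0 <= M * (d * (2 - d)) by rewrite !mulr_ge0 ?subr_ge0.
by rewrite expr2; lra.
Qed.

End SphereVectorField.

(** * Flows of vector fields on the sphere *)

Section EuclideanNorm.
Context {R : realType}.
Local Notation V := 'rV[R]_7.
Implicit Types (x y : V).

(** The Euclidean norm, as opposed to `|x|, which is the maximum norm. *)
Definition enorm x : R := Num.sqrt (dot x x).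

Lemma enorm_ge0 x : 0 <= enorm x. Proof. exact: sqrtr_ge0. Qed.

Lemma sqr_enorm x : enorm x ^+ 2 = dot x x.
Proof. by rewrite sqr_sqrtr// dot_ge0. Qed.

Lemma enorm_gt0 x : (0 < enorm x) = (x != 0).
Proof. by rewrite sqrtr_gt0 dot_gt0. Qed.

Lemma coord_le_enorm x j : `|x 0 j| <= enorm x.
Proof.
rewrite -sqrtr_sqr ler_sqrt; last exact: dot_ge0.
rewrite /dot (bigD1 j)//= -expr2 lerDl; apply: sumr_ge0 => i _.
by rewrite -expr2 sqr_ge0.
Qed.

Lemma enorm_normalize x : x = enorm x *: normalize x.
Proof.
rewrite /normalize -/(enorm x) scalerA.
have [->|x0] := eqVneq x 0; first by rewrite scaler0.
by rewrite divff ?scale1r// gt_eqF// enorm_gt0.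
Qed.

Lemma enorm_lipschitz x y : `|enorm x - enorm y| <= 7%:R * `|x - y|.
Proof.
have [s0|s0] := leP (enorm x + enorm y) 0.
  have x0 : enorm x = 0.
    by apply/eqP; rewrite eq_le enorm_ge0 andbT; have := enorm_ge0 y; lra.
  have y0 : enorm y = 0.
    by apply/eqP; rewrite eq_le enorm_ge0 andbT; have := enorm_ge0 x; lra.
  by rewrite x0 y0 subrr normr0 mulr_ge0.
rewrite -(ler_pM2r s0) -[in leLHS](gtr0_norm s0) -normrM -subr_sqr !sqr_enorm.
rewrite /dot -sumrB -mulrA.
apply: le_trans (ler_norm_sum _ _ _) _; apply: sum_le_const => j.
rewrite -!expr2 subr_sqr normrM ler_pM//.
  by have := normr_coord_le (x - y) j; rewrite !mxE.
by apply: le_trans (ler_normD _ _) _; rewrite lerD// coord_le_enorm.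
Qed.

End EuclideanNorm.

Section Flow.
Context {R : realType}.
Local Notation V := 'rV[R]_7.
Variable Z : V -> V.
Hypothesis Zvf : vector_field Z.

(** Homogeneous of degree 1 and tangent to all spheres centred at 0:
    Picard-Lindelof applies to it on R^7, and its integral curves keep their
    distance to the origin. *)
Definition radial_extension (x : V) : V := enorm x *: Z (normalize x).

(** With r = |x|, s = |y| and unit vectors x', y', write r Z x' - s Z y' = (r
    - s) Z x' + s (Z x' - Z y').  The first term is at most a constant times
    |x - y|, and so is the second, because s (x' - y') = (s - r) x' + (x - y).
    The origin is treated apart, since Z is not controlled at normalize 0 =
    0. *)
Lemma radial_extension_lipschitz : exists L : R, 0 < L /\
  forall x y, `|radial_extension x - radial_extension y| <= L * `|x - y|.
Proof.
have [B [B0 ZB]] := vector_field_bound Zvf.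
have [L [L0 ZL]] := vector_field_lipschitz Zvf.
have FB x : `|radial_extension x| <= B * enorm x.
  have [->|x0] := eqVneq x 0.
    by rewrite /radial_extension /enorm dot0r sqrtr0 scale0r normr0 mulr0.
  rewrite /radial_extension normrZ ger0_norm ?enorm_ge0// mulrC.
  by rewrite ler_wpM2r ?enorm_ge0//; apply/ZB/S6_normalize.
pose K := 7%:R * B + L * 8%:R.
have K7 : 7%:R * B <= K by rewrite lerDl mulr_ge0// ltW.
have F0 : radial_extension 0 = 0.
  by rewrite /radial_extension /enorm dot0r sqrtr0 scale0r.
have e0 : enorm (0 : V) = 0 by rewrite /enorm dot0r sqrtr0.
have FB' x : `|radial_extension x| <= K * `|x|.
  apply: le_trans (FB x) _; apply: (@le_trans _ _ (B * (7%:R * `|x|))).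
    rewrite ler_wpM2l//; have := enorm_lipschitz x 0.
    by rewrite e0 !subr0 ger0_norm// enorm_ge0.
  by rewrite mulrA (mulrC B) ler_wpM2r.
exists K; split; first by rewrite ltr_wpDl ?mulr_ge0// mulr_gt0.
move=> x y; have [->|x0] := eqVneq x 0.
  by rewrite F0 !sub0r !normrN.
have [->|y0] := eqVneq y 0; first by rewrite F0 !subr0.
have -> : radial_extension x - radial_extension y =
    (enorm x - enorm y) *: Z (normalize x) +
    enorm y *: (Z (normalize x) - Z (normalize y)).
  by rewrite scalerBl scalerBr addrA subrK.
apply: le_trans (ler_normD _ _) _; rewrite !normrZ /K mulrDl; apply: lerD.
  rewrite (mulrAC _ B) ler_pM//; first exact: enorm_lipschitz.
  exact/ZB/S6_normalize.
rewrite (ger0_norm (enorm_ge0 y)).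
apply: (@le_trans _ _ (enorm y * (L * `|normalize x - normalize y|))).
  by rewrite ler_wpM2l ?enorm_ge0//; apply: ZL; exact: S6_normalize.
rewrite mulrCA -mulrA ler_wpM2l ?(ltW L0)//.
rewrite -(ger0_norm (enorm_ge0 y)) -normrZ scalerBr -enorm_normalize.
have -> : enorm y *: normalize x - y =
    - (enorm x - enorm y) *: normalize x + (x - y).
  by rewrite opprB scalerBl -enorm_normalize addrA subrK.
apply: le_trans (ler_normD _ _) _; rewrite normrZ normrN.
have -> : 8%:R * `|x - y| = 7%:R * `|x - y| + `|x - y| by ring.
rewrite lerD2r -[leRHS]mulr1 ler_pM// ?enorm_lipschitz//.
exact/S6_norm_le/S6_normalize.
Qed.

Lemma dot_radial_extension x : dot x (radial_extension x) = 0.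
Proof.
have [->|x0] := eqVneq x 0; first by rewrite dotC dot0r.
have T : dot (normalize x) (Z (normalize x)) = 0.
  by case: Zvf => _; apply; exact: S6_normalize.
rewrite {1}[x]enorm_normalize /radial_extension dotZr dotC dotZr dotC T.
by rewrite !mulr0.
Qed.

Lemma radial_extensionE p : S6 p -> radial_extension p = Z p.
Proof.
move=> Sp; rewrite /radial_extension normalize_S6// /enorm.
by rewrite (Sp : dot p p = 1) sqrtr1 scale1r.
Qed.

Lemma is_derive_dot (c dc : R -> V) (t : R) : is_derive t 1 c (dc t) ->
  is_derive t 1 (fun t => dot (c t) (c t)) (2 * dot (c t) (dc t)).
Proof.
move=> cd; have := is_derive_comp_curve cd (differentiable_dot (c t)).
by rewrite derive_dot.
Qed.

Definition integral_curve (c : R -> V) :=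
  (forall t, S6 (c t)) /\ forall t : R, is_derive t 1 c (Z (c t)).

Lemma integral_curve_exists p : S6 p ->
  exists c, c 0 = p /\ integral_curve c.
Proof.
move=> Sp; have [L [L0 FL]] := radial_extension_lipschitz.
have [c [c0 cd]] := picard_lindelof L0 FL p.
have dd (t : R) : is_derive t 1 (fun t => dot (c t) (c t)) 0.
  have := is_derive_dot (cd t) (dc := fun t => radial_extension (c t)).
  by rewrite dot_radial_extension mulr0.
have Sc t : S6 (c t).
  rewrite /S6/=; rewrite (is_derive_0_is_cst t 0 dd) c0.
  exact: Sp.
exists c; split => //; split=> // t; rewrite -radial_extensionE//; exact: cd.
Qed.

Lemma integral_curve_dist : exists K : R, forall c1 c2 t,
  integral_curve c1 -> integral_curve c2 ->
  `|c1 t - c2 t| ^+ 2 <= 7%:R * `|c1 0 - c2 0| ^+ 2 * expR (K * `|t|).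
Proof.
have [L [L0 ZL]] := vector_field_lipschitz Zvf.
exists (7%:R * (2 * L + 1)) => c1 c2 t [S1 d1] [S2 d2].
have dd (s : R) : is_derive s 1 (fun s => c1 s - c2 s) (Z (c1 s) - Z (c2 s)).
  by have ? := d1 s; have ? := d2 s; apply: is_derive_eq.
have := @gronwall_row R 7 (fun s => c1 s - c2 s) _ L 0 t (ltW L0) (lexx 0) dd.
rewrite expr0n/= addr0; apply => s _; rewrite addr0; exact: ZL.
Qed.

Lemma integral_curve_unique c1 c2 : integral_curve c1 -> integral_curve c2 ->
  c1 0 = c2 0 -> c1 = c2.
Proof.
move=> i1 i2 c0; have [K HK] := integral_curve_dist.
apply/funext => t; have := HK c1 c2 t i1 i2.
rewrite c0 subrr normr0 expr0n/= mulr0 mul0r => H.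
by apply/eqP; rewrite -subr_eq0 -normr_eq0 -sqrf_eq0 eq_le H exprn_ge0.
Qed.

(** An integral curve through each point of the sphere gives a flow, so the
    choice made in the definition of flow is not its default value. *)
Lemma flow_is_flow : is_flow Z (flow Z).
Proof.
pose phi t p : V := if pselect (S6 p) is left Sp
  then sval (cid (integral_curve_exists Sp)) t else p.
apply: (@xgetI _ _ [set phi | is_flow Z phi] phi) => p Sp.
rewrite /phi; case: pselect => // Sp'.
have [c0 [cS cd]] := svalP (cid (integral_curve_exists Sp')).
by split.
Qed.

Lemma flow0 p : S6 p -> flow Z 0 p = p.
Proof. by case/flow_is_flow. Qed.

Lemma flow_S6 p t : S6 p -> S6 (flow Z t p).
Proof. by case/flow_is_flow. Qed.

Lemma flow_integral p : S6 p -> integral_curve (fun t => flow Z t p).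
Proof. by case/flow_is_flow. Qed.

Lemma flow_unique p c : S6 p -> integral_curve c -> c 0 = p ->
  forall t, c t = flow Z t p.
Proof.
move=> Sp ic c0 t; have := integral_curve_unique ic (flow_integral Sp).
by rewrite flow0// => /(_ c0) ->.
Qed.

Lemma flowD p s t : S6 p -> flow Z (s + t) p = flow Z s (flow Z t p).
Proof.
move=> Sp; apply: (flow_unique (c := fun s => flow Z (s + t) p)).
- exact: flow_S6.
- split=> [u|u]; first exact: flow_S6.
  have [_ fd] := flow_integral Sp; have [fdd fde] := fd (u + t).
  have sd : is_derive u 1 (fun s : R => s + t) 1.
    by apply: is_derive_eq; rewrite addr0.
  have := is_derive_comp_curve sd ((derivable1_diffP _ _).1 fdd).
  by rewrite fde.
- by rewrite add0r.
Qed.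

(** Integrating |Z (flow Z s p) - Z p| <= L |flow Z s p - p| <= L B |s|. *)
Lemma flow_taylor : exists C : R, 0 <= C /\ forall p t, S6 p ->
  `|flow Z t p - p| <= C * `|t| /\ `|flow Z t p - p - t *: Z p| <= C * t ^+ 2.
Proof.
have [B [B0 ZB]] := vector_field_bound Zvf.
have [L [L0 ZL]] := vector_field_lipschitz Zvf.
exists (B + L * B); split; first by rewrite addr_ge0 ?mulr_ge0// ltW.
move=> p t Sp; have [fS fd] := flow_integral Sp.
have first_order s : `|flow Z s p - p| <= B * `|s|.
  have := @derive_bound_lip R 7 _ _ B 0 s B0 fd.
  by rewrite flow0// subr0; apply => u _; apply/ZB/fS.
split.
  by apply: le_trans (first_order t) _; rewrite ler_wpM2r// lerDl mulr_ge0// ltW.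
have gd (s : R) : is_derive s 1 (fun s => flow Z s p - s *: Z p)
    (Z (flow Z s p) - Z p).
  have ? : is_derive s 1 (fun s : R => s *: Z p) (Z p).
    apply: is_derive_row => j.
    rewrite (_ : (fun y => _) = (fun y : R => y * Z p 0 j)).
      by apply: is_derive_eq; rewrite scaler0 add0r [_ *: _]mulr1.
    by apply/funext => y; rewrite mxE.
  by have ? := fd s; apply: is_derive_eq.
have LB0 : 0 <= L * B * `|t| by rewrite !mulr_ge0// ltW.
have := @derive_bound_lip R 7 _ _ (L * B * `|t|) 0 t LB0 gd _.
rewrite flow0// scale0r !subr0 normr0 => H.
have {}H := H _; rewrite addrAC.
apply: le_trans (H _) _.
  move=> s st; apply: le_trans (ZL _ _ (fS s) Sp) _.
  rewrite -mulrA ler_wpM2l ?(ltW L0)//; apply: le_trans (first_order s) _.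
  by rewrite ler_wpM2l//; apply: le_trans st _; rewrite ge_max normr_ge0 lexx.
rewrite -mulrA -expr2 real_normK ?num_real// ler_wpM2r ?sqr_ge0//.
by rewrite lerDr.
Qed.

End Flow.

(** * Commuting flows and their joint orbit map *)

Section CommutingFlows.
Context {R : realType}.
Local Notation V := 'rV[R]_7.
Variables X Y : V -> V.
Hypotheses (Xvf : vector_field X) (Yvf : vector_field Y).
Hypothesis XY0 : forall p, S6 p -> lie_bracket X Y p = 0.

(** The remainder r of the left-hand side solves r' = DY.r + (Taylor remainder
    of Y between the two orbits); the bracket condition replaces h DX.Y by h
    DY.X.  The two orbits of Y start at distance O(h) and stay at distance
    O(h) up to time t, so both the Taylor remainder and r at time 0 are
    O(h^2). *)
Lemma flow_transport p t : S6 p -> exists C : R, forall h,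
  `|flow Y t (flow X h p) - flow Y t p - h *: X (flow Y t p)| <= C * h ^+ 2.
Proof.
move=> Sp; have [D [D0 YD]] := vector_field_derive_bound Yvf.
have [M [M0 YM]] := vector_field_taylor Yvf.
have [C1 [C10 XC]] := flow_taylor Xvf.
have [K HK] := integral_curve_dist Yvf.
pose E := expR (`|K| * `|t|); have E0 : 0 <= E by exact: expR_ge0.
pose c0 := M * (7%:R * C1 ^+ 2 * E).
have c00 : 0 <= c0 by rewrite !mulr_ge0 ?exprn_ge0.
pose F := (7%:R * C1 ^+ 2 + c0 ^+ 2) * expR (7%:R * (2 * D + 1) * `|t|).
have F0 : 0 <= F by rewrite mulr_ge0 ?expR_ge0 ?addr_ge0 ?mulr_ge0 ?sqr_ge0.
exists (Num.sqrt F) => h.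
have Sq : S6 (flow X h p) by exact: flow_S6.
have [Sa da] := flow_integral Yvf Sp.
have [Sb db] := flow_integral Yvf Sq.
set q := flow X h p in Sq Sb db *.
pose a s := flow Y s p; pose b s := flow Y s q.
pose r s := b s - a s - h *: X (a s).
pose dr s := Y (b s) - Y (a s) - h *: 'D_(Y (a s)) (X \o @normalize R) (a s).
have rd (s : R) : is_derive s 1 r (dr s).
  have xd := is_derive_comp_curve (da s) (differentiable_ext Xvf (Sa s)).
  have xd' : is_derive s 1 (fun s => h *: X (a s))
      (h *: 'D_(Y (a s)) (X \o @normalize R) (a s)).
    have -> : (fun s => h *: X (a s)) =
        h \*: ((X \o @normalize R) \o (fun s => flow Y s p)).
      by apply/funext => u /=; rewrite /a normalize_S6.
    exact: is_deriveZ.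
  by have ? := da s; have ? := db s; apply: is_derive_eq.
have qp : `|q - p| ^+ 2 <= C1 ^+ 2 * h ^+ 2.
  rewrite -[h ^+ 2]real_normK ?num_real// -exprMn.
  by rewrite lerXn2r ?nnegrE ?mulr_ge0//; exact: (XC p h Sp).1.
have ab s : `|s| <= `|t| -> `|b s - a s| ^+ 2 <= 7%:R * C1 ^+ 2 * E * h ^+ 2.
  move=> st; apply: le_trans (HK b a s _ _) _; try by split.
  rewrite /a /b !flow0//.
  have -> : 7%:R * C1 ^+ 2 * E * h ^+ 2 = 7%:R * (C1 ^+ 2 * h ^+ 2) * E by ring.
  apply: ler_pM; [by rewrite mulr_ge0|exact: expR_ge0| |].
    by rewrite ler_wpM2l.
  rewrite /E ler_expR; apply: (@le_trans _ _ (`|K| * `|s|)).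
    by rewrite ler_wpM2r// ler_norm.
  by rewrite ler_wpM2l.
have drb s : `|s| <= `|t| -> `|dr s| <= D * `|r s| + c0 * h ^+ 2.
  move=> st; have Yd := differentiable_ext Yvf (Sa s).
  have br : 'D_(Y (a s)) (X \o @normalize R) (a s) =
            'D_(X (a s)) (Y \o @normalize R) (a s).
    by apply/esym/eqP; rewrite -subr_eq0; apply/eqP; exact: XY0 (Sa s).
  have Dr : 'D_(r s) (Y \o @normalize R) (a s) =
      'D_(b s - a s) (Y \o @normalize R) (a s) -
      h *: 'D_(X (a s)) (Y \o @normalize R) (a s).
    by rewrite -!diff_derive// /r linearB linearZ.
  have -> : dr s = 'D_(r s) (Y \o @normalize R) (a s) +
      (Y (b s) - Y (a s) - 'D_(b s - a s) (Y \o @normalize R) (a s)).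
    by rewrite /dr br Dr [RHS]addrC addrA subrK.
  apply: le_trans (ler_normD _ _) _; apply: lerD; first exact: YD (Sa s).
  apply: le_trans (YM _ _ (Sa s) (Sb s)) _.
  by rewrite /c0 -mulrA ler_wpM2l//; exact: ab.
have c0h : 0 <= c0 * h ^+ 2 by rewrite mulr_ge0 ?sqr_ge0.
have := gronwall_row D0 c0h rd drb; rewrite -/(r t) => H.
have r0 : `|r 0| ^+ 2 <= C1 ^+ 2 * (h ^+ 2) ^+ 2.
  have r0' : `|r 0| <= C1 * h ^+ 2.
    by rewrite /r /a /b !flow0//; exact: (XC p h Sp).2.
  have C1h : 0 <= C1 * h ^+ 2 by rewrite mulr_ge0 ?sqr_ge0.
  by rewrite -exprMn lerXn2r ?nnegrE.
rewrite -/(a t) -/(b t) -/(r t).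
have Fh : 0 <= Num.sqrt F * h ^+ 2 by rewrite mulr_ge0 ?sqrtr_ge0 ?sqr_ge0.
rewrite -(@ler_pXn2r _ 2)// ?nnegrE//.
rewrite exprMn sqr_sqrtr//; apply: le_trans H _.
rewrite /F [leRHS]mulrAC ler_wpM2r ?expR_ge0// [leRHS]mulrDl [in leLHS]exprMn lerD2r -mulrA.
by rewrite ler_wpM2l.
Qed.

(** By the group law [flow_transport] gives the derivative at every s: the
    left-hand side is an integral curve of X, starting at flow Y t p. *)
Lemma flows_commute p s t : S6 p ->
  flow Y t (flow X s p) = flow X s (flow Y t p).
Proof.
move=> Sp; apply: (flow_unique Xvf (c := fun s => flow Y t (flow X s p))).
- exact: flow_S6.
- split=> [u|u]; first by apply: flow_S6 => //; exact: flow_S6.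
  have Su : S6 (flow X u p) by exact: flow_S6.
  have [C HC] := flow_transport t Su.
  by apply: (quadratic_is_derive (C := C)) => h; rewrite flowD.
- by rewrite flow0.
Qed.

Local Notation psi := (psi X Y).

Lemma psi_S6 p s : S6 p -> S6 (psi p s).
Proof. by move=> Sp; apply: flow_S6 => //; exact: flow_S6. Qed.

Lemma psi0 p : S6 p -> psi p 0 = p.
Proof. by move=> Sp; rewrite /Defs.psi !mxE !flow0. Qed.

Lemma psiD p s t : S6 p -> psi p (s + t) = psi (psi p t) s.
Proof.
move=> Sp; have SX u : S6 (flow X u p) by exact: flow_S6.
by rewrite /Defs.psi !mxE flowD// flowD// flows_commute.
Qed.

(** The differential of psi at every parameter t with psi p t = q. *)
Definition frame_map (p : V) (h : 'rV[R]_2) : V :=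
  h 0 0 *: X p + h 0 1 *: Y p.

Lemma frame_map_linear p : linear (frame_map p).
Proof.
by move=> a u v; rewrite /frame_map; apply/rowP => j; rewrite !mxE; ring.
Qed.

Lemma frame_map_continuous p : continuous (frame_map p).
Proof.
have oT := @openT 'rV[R]_2; move=> h.
have /(_ h) : Ck 0 setT (frame_map p); last exact.
have coord i := Ck_coord i oT (Ck_id 0 (@setT 'rV[R]_2)).
exact: (CkD oT (CkZl (X p) oT (coord 0)) (CkZl (Y p) oT (coord 1))).
Qed.

(** Expand the two flows one after the other; the cross term comes from
    evaluating Y at flow X (h 0 0) p instead of p. *)
Lemma psi_taylor : exists C : R, forall p h, S6 p ->
  `|psi p h - p - frame_map p h| <= C * `|h| ^+ 2.
Proof.
have [CX [CX0 TX]] := flow_taylor Xvf; have [CY [CY0 TY]] := flow_taylor Yvf.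
have [L [L0 YL]] := vector_field_lipschitz Yvf.
exists (CY + CX + L * CX) => p h Sp.
have SX : S6 (flow X (h 0 0) p) by exact: flow_S6.
have h0 := normr_coord_le h 0; have h1 := normr_coord_le h 1.
have sq (a : R) : `|a| <= `|h| -> a ^+ 2 <= `|h| ^+ 2.
  by move=> ah; rewrite -[a ^+ 2]real_normK ?num_real// lerXn2r ?nnegrE.
set q := flow X (h 0 0) p in SX.
have -> : psi p h - p - frame_map p h =
  (flow Y (h 0 1) q - q - h 0 1 *: Y q) + (q - p - h 0 0 *: X p) +
  h 0 1 *: (Y q - Y p).
  by rewrite /frame_map /Defs.psi -/q; apply/rowP => j; rewrite !mxE; ring.
apply: le_trans (ler_normD _ _) _; rewrite !mulrDl; apply: lerD.
  apply: le_trans (ler_normD _ _) _; apply: lerD.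
    by apply: le_trans (TY q (h 0 1) SX).2 _; rewrite ler_wpM2l// sq.
  by apply: le_trans (TX p (h 0 0) Sp).2 _; rewrite ler_wpM2l// sq.
rewrite normrZ expr2 mulrA [leRHS]mulrC ler_pM//.
apply: le_trans (YL _ _ SX Sp) _; rewrite -mulrA ler_wpM2l ?(ltW L0)//.
by apply: le_trans (TX p (h 0 0) Sp).1 _; rewrite ler_wpM2l.
Qed.

(** The group law moves the expansion at the parameter 0 to any parameter. *)
Lemma psi_is_diff p t : S6 p -> is_diff t (psi p) (frame_map (psi p t)).
Proof.
move=> Sp; have [C HC] := psi_taylor.
apply: (quadratic_is_diff (C := C)).
- exact: frame_map_linear.
- exact: frame_map_continuous.
- by move=> h; rewrite psiD//; apply: HC; exact: psi_S6.
Qed.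

Lemma smooth_psi p : S6 p -> smooth_on setT (psi p).
Proof.
move=> Sp; have oT := @openT 'rV[R]_2.
have psid t : differentiable (psi p) t by have [] := psi_is_diff t Sp.
have field_ext (Z : V -> V) k : vector_field Z -> Ck k setT (psi p) ->
    Ck k setT (fun t => Z (psi p t)).
  move=> [Zs _] psik.
  have := Ck_comp oT (@open_punctured R) (fun t _ => S6_neq0 (psi_S6 t Sp)) psik
    (smooth_extension Zs k).
  by apply: Ck_eq => // t _ /=; rewrite normalize_S6//; exact: psi_S6.
elim=> [|k IH]; first by move=> t _; exact: differentiable_continuous.
split=> [//|v].
have kX := CkZr oT (Ck_cst k setT (v 0 0)) (field_ext X k Xvf IH).
have kY := CkZr oT (Ck_cst k setT (v 0 1)) (field_ext Y k Yvf IH).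
apply: Ck_eq oT _ (CkD oT kX kY) => t _ /=.
by rewrite -diff_derive//; have [_ ->] := psi_is_diff t Sp.
Qed.

End CommutingFlows.

(** * Leaves: the orbits of the joint flow *)

Section Leaves.
Context {R : realType}.
Local Notation V := 'rV[R]_7.
Variable X : V -> V.
Hypothesis Xvf : vector_field X.
Local Notation JX := (Jfield X).
Hypothesis XJX0 : forall p, S6 p -> lie_bracket X JX p = 0.
Let JXvf : vector_field JX := vector_field_Jfield Xvf.
Local Notation psi := (psi X JX).
Local Notation frame := (frame_map X JX).

Let psiDX p s t : S6 p -> psi p (s + t) = psi (psi p t) s.
Proof. exact: psiD. Qed.

Let psi0X p : S6 p -> psi p 0 = p.
Proof. exact: psi0. Qed.

Lemma range_psi_eq p t : S6 p -> range (psi (psi p t)) = range (psi p).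
Proof.
move=> Sp; apply/seteqP; split => [_ [s _ <-]|_ [s _ <-]].
  by exists (s + t); rewrite // psiDX.
by exists (s - t); rewrite // -psiDX// subrK.
Qed.

Lemma psi_isotropy p s t : S6 p -> psi p s = psi p t -> psi p (s - t) = p.
Proof.
move=> Sp st; rewrite addrC psiDX// st -psiDX// addNr psi0X//.
Qed.

Lemma dot_XJX q : dot (X q) (JX q) = 0.
Proof. exact: dot_crossr. Qed.

Lemma dot_JXJX q : S6 q -> dot (JX q) (JX q) = dot (X q) (X q).
Proof.
move=> Sq; rewrite /Jfield /Jstr dot_cross_cycle cross_crossr.
have qX : dot q (X q) = 0 by case: Xvf => _; exact.
rewrite -scaleN1r dotDr !dotZr qX !mulr0 addr0.
by rewrite (Sq : dot q q = 1) mulr1.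
Qed.

Lemma dot_frame q h : S6 q ->
  dot (frame q h) (frame q h) = (h 0 0 ^+ 2 + h 0 1 ^+ 2) * dot (X q) (X q).
Proof.
move=> Sq; rewrite /frame_map dotDr !dotZr ![dot (_ + _) _]dotC !dotDr !dotZr.
by rewrite [dot (JX q) (X q)]dotC dot_XJX dot_JXJX//; ring.
Qed.

(** X and JX are orthogonal and of the same length; the factor 7 compares the
    maximum norm with the Euclidean one. *)
Lemma frame_lower_bound q h : S6 q ->
  `|h| ^+ 2 * dot (X q) (X q) <= 7%:R * `|frame q h| ^+ 2.
Proof.
move=> Sq; apply: le_trans (sum_le_sqr_norm (frame q h)).
have -> : \sum_j frame q h 0 j ^+ 2 = dot (frame q h) (frame q h).
  by apply: eq_bigr => j _; rewrite expr2.
rewrite dot_frame// ler_wpM2r ?dot_ge0//.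
apply: le_trans (sqr_norm_le_sum h) _.
by rewrite big_ord_recl big_ord1 (_ : lift ord0 ord0 = 1)//; exact: val_inj.
Qed.

Lemma frame_injective q : S6 q -> X q != 0 -> injective (frame q).
Proof.
move=> Sq; rewrite -dot_gt0 => X0 u v uv; apply/eqP; rewrite -subr_eq0.
have fl := frame_map_linear X JX q.
have f0 : frame q (u - v) = 0.
  have -> : u - v = -1 *: v + u by rewrite scaleN1r addrC.
  by rewrite fl uv scaleN1r addNr.
have := frame_lower_bound (u - v) Sq; rewrite f0 normr0 expr0n/= mulr0.
by rewrite pmulr_lle0// => H; rewrite -normr_eq0 -sqrf_eq0 eq_le H sqr_ge0.
Qed.

(** If psi p h = p, the Taylor estimate bounds frame p h by C |h|^2, while it
    is at least of order |h|. *)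
Lemma psi_isolated p : S6 p -> X p != 0 -> exists delta : R, 0 < delta /\
  forall h, `|h| < delta -> psi p h = p -> h = 0.
Proof.
move=> Sp; rewrite -dot_gt0 => X0; have [C HC] := psi_taylor Xvf JXvf.
have CC0 : 0 <= 7%:R * C ^+ 2 by apply: mulr_ge0 => //; exact: sqr_ge0.
pose A := 7%:R * C ^+ 2 + 1; have A0 : 0 < A by rewrite ltr_wpDl.
(* for |h| <= 1 one has 7 C^2 |h|^2 <= A |h|, so that |h| < |X p|^2 / A
   contradicts the lower bound on the frame *)
exists (Num.min 1 (dot (X p) (X p) / A)); split.
  by rewrite lt_min ltr01 divr_gt0.
move=> h; rewrite lt_min ltr_pdivlMr// => /andP[h1 hA] ph.
apply/eqP; apply: contraT; rewrite -normr_gt0 => h0.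
have := frame_lower_bound h Sp; have := HC p h Sp.
rewrite ph subrr sub0r normrN => fC fl.
have C0 : 0 <= C.
  have h2 : 0 < `|h| ^+ 2 by rewrite exprn_gt0.
  by rewrite -(pmulr_lge0 _ h2); apply: le_trans fC.
have : `|frame p h| ^+ 2 <= (C * `|h| ^+ 2) ^+ 2.
  by rewrite lerXn2r ?nnegrE ?(le_trans _ fC).
rewrite exprMn => fC2.
have : `|h| ^+ 2 * dot (X p) (X p) <= `|h| ^+ 2 * (7%:R * C ^+ 2 * `|h| ^+ 2).
  apply: le_trans fl _; apply: (@le_trans _ _ (7%:R * (C ^+ 2 * `|h| ^+ 2 ^+ 2))).
    by rewrite ler_wpM2l.
  by rewrite le_eqVlt; apply/orP; left; apply/eqP; ring.
rewrite ler_pM2l ?exprn_gt0// => H.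
have : 7%:R * C ^+ 2 * `|h| ^+ 2 <= A * `|h|.
  apply: ler_pM; rewrite ?sqr_ge0// ?lerDl//.
  by rewrite expr2 ler_piMl// ltW.
by move: H hA; rewrite (mulrC A); lra.
Qed.

Lemma psi_stationary p t : S6 p -> X p = 0 -> psi p t = p.
Proof.
move=> Sp X0; have JX0 : JX p = 0 by rewrite /Jfield X0 /Jstr cross0r.
have icst (Z : V -> V) : Z p = 0 -> integral_curve Z (fun=> p).
  by move=> Z0; split=> // s; rewrite Z0; exact: is_derive_cst.
rewrite /Defs.psi -(flow_unique Xvf Sp (icst _ X0))//.
by rewrite -(flow_unique JXvf Sp (icst _ JX0)).
Qed.

Lemma memv_spanXJX q w :
  (w \in spanXJX X q) <-> exists h, w = frame q h.
Proof.
rewrite /spanXJX span_cons span_seq1; split.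
  move=> /memv_addP[_ /vlineP[a ->] [_ /vlineP[b ->] ->]].
  exists (\row_j if j == 0 then a else b).
  by rewrite /frame_map !mxE.
by move=> [h ->]; rewrite memv_add// memvZ// memv_line.
Qed.

Lemma is_leaf_point p : S6 p -> X p = 0 -> is_leaf (spanXJX X) [set p].
Proof.
move=> Sp X0; exists 0%N, (fun=> setT), (fun _ _ => p).
have uniq0 (u v : 'rV[R]_0) : u = v by rewrite (thinmx0 u) (thinmx0 v).
split.
- split=> //.
  + apply/seteqP; split => [q [i _ [x _ <-]]//|q ->].
    by exists 0%N => //; exists 0.
  + by move=> _; split; [exact: openT|move=> u v _ _ _; exact: uniq0].
  + by move=> _ k; exact: Ck_cst.
  + by move=> i x _ u v _; exact: uniq0.
  + move=> i j x _ _; exists setT, id; split => //; first exact: openT.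
    by move=> k; exact: Ck_id.
- move=> O Op [q Oq] _ _; apply/seteqP; split => // _ ->.
  by have := Op q Oq => <-.
- move=> q ->; apply/seteqP; split => [w [i [x [_ _ [v ->]]]]|w /memv_spanXJX[h ->]].
    by rewrite diff_cst; exact: mem0v.
  exists 0%N, 0; split => //; exists 0; rewrite linear0 /frame_map X0 /Jfield.
  by rewrite X0 /Jstr cross0r !scaler0 addr0.
Qed.

End Leaves.

(** * Orbits of dimension two *)

Section SurfaceLeaves.
Context {R : realType}.
Local Notation V := 'rV[R]_7.

(** Indexed by nat, as atlases are, through an enumeration of the pairs of
    integers. *)
Definition grid_point (e : R) (i : nat) : 'rV[R]_2 :=
  let ab := odflt (0, 0) (unpickle i : option (int * int)) in
  \row_j (e * (if j == 0 then ab.1 else ab.2)%:~R).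

Lemma grid_cover (e : R) (t : 'rV[R]_2) : 0 < e ->
  exists i, `|grid_point e i - t| <= e.
Proof.
move=> e0; pose a := Num.floor (t 0 0 / e); pose b := Num.floor (t 0 1 / e).
exists (pickle (a, b)); apply: normr_row_le => [|j]; first exact: ltW.
have fl (x : R) : `|e * (Num.floor (x / e))%:~R - x| <= e.
  have xe : x = e * (x / e) by rewrite mulrC divfK// gt_eqF.
  rewrite {2}xe -mulrBr normrM gtr0_norm// -[leRHS]mulr1 ler_wpM2l ?(ltW e0)//.
  have := floor_le (x / e); have := floorD1_gt (x / e).
  rewrite intrD distrC => H1 H2; rewrite ger0_norm ?subr_ge0//; lra.
rewrite !mxE pickleK/=; case: eqP => [->|/eqP j0]; first exact: fl.
by have -> : j = 1; [case: j j0 => -[|[|//]] //= ? _; exact: val_inj|exact: fl].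
Qed.

(** A segment joining a point of A to a point of B would disconnect the real
    line. *)
Lemma plane_connected (A B : set 'rV[R]_2) : open A -> open B ->
  A `&` B = set0 -> A `|` B = setT -> A !=set0 -> B = set0.
Proof.
move=> oA oB AB0 ABT [t0 At0]; apply/seteqP; split => // t1 Bt1.
pose c (s : R) := t0 + s *: (t1 - t0).
have cc : continuous c.
  move=> s; apply: cvgD; first exact: cvg_cst.
  by apply: cvgZr_tmp; exact: cvg_id.
have /connected_intervalP : is_interval (@setT R) by [].
move=> /(_ (c @^-1` A)) H.
have : c @^-1` A = setT.
  apply: H.
  - by exists 0; rewrite /= /c scale0r addr0.
  - exists (c @^-1` A); rewrite ?setTI//.
    by apply: open_comp => // s _; exact: cc.
  - exists (c @^-1` (~` B)).
      apply: closed_comp => [s _|]; first exact: cc.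
      exact: open_closedC.
    rewrite setTI; congr (_ @^-1` _); apply/seteqP; split => x.
      by move=> Ax Bx; have : (A `&` B) x by []; rewrite AB0.
    by move=> Bx; have [//|/Bx] : (A `|` B) x by rewrite ABT.
move=> /seteqP[_ /(_ 1 I)]; rewrite /= /c scale1r subrKC => At1.
by have : (A `&` B) t1 by []; rewrite AB0.
Qed.

Variable X : V -> V.
Hypothesis Xvf : vector_field X.
Local Notation JX := (Jfield X).
Hypothesis XJX0 : forall p, S6 p -> lie_bracket X JX p = 0.
Let JXvf : vector_field JX := vector_field_Jfield Xvf.
Local Notation psi := (psi X JX).
Local Notation frame := (frame_map X JX).

(** The charts are the restrictions of psi p to balls of radius delta / 2
    around the points of a grid, where delta bounds the periods of psi p from
    below; the grid only serves to have countably many. *)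
Lemma is_leaf_surface p : S6 p -> X p != 0 -> is_leaf (spanXJX X) (range (psi p)).
Proof.
move=> Sp X0; have [delta [delta0 iso]] := psi_isolated Xvf Sp X0.
have pS t : S6 (psi p t) by exact: psi_S6.
have Xn0 t : X (psi p t) != 0.
  apply: contra X0 => /eqP Xt; have := psi_stationary Xvf (- t) (pS t) Xt.
  rewrite -psiD// addNr psi0// => pt; rewrite {1}pt; exact/eqP.
have dpsi t := psi_is_diff Xvf JXvf XJX0 t Sp.
pose c := grid_point (delta / 4); pose U (i : nat) : set 'rV[R]_2 := ball (c i) (delta / 2).
have d2 : 0 < delta / 2 by rewrite divr_gt0.
have UE i (t : 'rV[R]_2) : U i t = (`|c i - t| < delta / 2) :> Prop.
  by rewrite /U -ball_normE.
have oU i : open (U i) by exact: ball_open.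
have cover (t : 'rV[R]_2) : exists i, U i t.
  have [|i Hi] := grid_cover (e := delta / 4) t; first by rewrite divr_gt0.
  by exists i; rewrite UE; apply: le_lt_trans Hi _; lra.
exists 2, U, (fun=> psi p); split.
- split.
  + apply/seteqP; split => [q [i _ [t _ <-]]|q [t _ <-]]; first by exists t.
    by have [i Ut] := cover t; exists i => //; exists t.
  + move=> i; split; first exact: oU.
    move=> s t /set_mem; rewrite UE => si /set_mem; rewrite UE => ti st.
    apply/eqP; rewrite -subr_eq0; apply/eqP/iso.
      have -> : s - t = (c i - t) - (c i - s) by rewrite opprB [RHS]addrC subrKA.
      by apply: le_lt_trans (ler_normB _ _) _; lra.
    exact: psi_isotropy.
  + by move=> i k; apply: Ck_sub (smooth_psi Xvf JXvf XJX0 Sp k).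
  + move=> i t _; have [_ ->] := dpsi t.
    exact: frame_injective.
  (* y - x is a period of psi p, and z |-> z + (y - x) changes charts *)
  + move=> i j x Ux [y Uy yx].
    exists (U i `&` ball (c j - (y - x)) (delta / 2)), (fun z => z + (y - x)).
    have jE z : ball (c j - (y - x)) (delta / 2) z = U j (z + (y - x)) :> Prop.
      rewrite UE -ball_normE /ball_/=.
      by have -> : c j - (z + (y - x)) = c j - (y - x) - z
        by rewrite [z + _]addrC opprD addrA.
    split.
    * by apply: openI => //; exact: ball_open.
    * by split => //; rewrite jE addrC subrK.
    * by move=> z [].
    * move=> k; apply: CkD; [|exact: Ck_id|exact: Ck_cst].
      by apply: openI => //; exact: ball_open.
    * move=> z [_]; rewrite jE; split => //.
      by rewrite psiD// (psi_isotropy Xvf XJX0 Sp yx).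
- move=> O OL [q Oq] oO oC.
  have preim_open (Q : set V) : atlas_open U (fun=> psi p) Q ->
      open (psi p @^-1` Q).
    move=> oQ; have -> : psi p @^-1` Q = \bigcup_i (U i `&` psi p @^-1` Q).
      apply/seteqP; split => [t Qt|t [i _ []]//].
      by have [i Ut] := cover t; exists i.
    by apply: bigcup_open => i _; exact: oQ.
  have B0 := plane_connected (preim_open _ oO) (preim_open _ oC).
  apply/seteqP; split => // _ [t _ <-]; apply: contrapT => Ot.
  suff : psi p @^-1` (range (psi p) `\` O) = set0.
    by move=> /seteqP[/(_ t) H _]; apply: H; split => //; exists t.
  apply: B0.
  + by apply/seteqP; split => // s [/= Os [_ /(_ Os)]].
  + apply/seteqP; split => // s _; have [Os|Os] := pselect (O (psi p s)).
      by left.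
    by right; split => //; exists s.
  + by have [s _ sq] := OL q Oq; exists s; rewrite /= sq.
- move=> q [t _ <-]; apply/seteqP; split.
    move=> w [i [x [_ xt [v ->]]]]; apply/memv_spanXJX; exists v.
    by rewrite -xt; have [_ ->] := dpsi x.
  move=> w /memv_spanXJX[v ->]; have [i Ut] := cover t.
  by exists i, t; split => //; exists v; have [_ ->] := dpsi t.
Qed.

Lemma bracket_XJX_eq0 : lie_derivative_J_eq0 X ->
  forall p, S6 p -> lie_bracket X JX p = 0.
Proof.
move=> /(_ X Xvf) LX p Sp; have := LX p Sp; rewrite /lie_derivative_J.
by rewrite /lie_bracket subrr /Jstr cross0r subr0.
Qed.

End SurfaceLeaves.

(** * The foliation and the dynamical equation *)

Section Foliation.
Context {R : realType}.
Local Notation V := 'rV[R]_7.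
Variable X : V -> V.
Hypothesis Xvf : vector_field X.
Local Notation JX := (Jfield X).
Hypothesis XJX0 : forall p, S6 p -> lie_bracket X JX p = 0.
Let JXvf : vector_field JX := vector_field_Jfield Xvf.
Local Notation psi := (psi X JX).
Local Notation frame := (frame_map X JX).

Let X_tangent q : S6 q -> dot q (X q) = 0.
Proof. by case: Xvf => _; exact. Qed.

Lemma spanXJX_tangent q : S6 q -> [set u | u \in spanXJX X q] `<=` TS6 q.
Proof.
move=> Sq _ /memv_spanXJX[h ->]; rewrite /TS6/= dotDr !dotZr X_tangent//.
by rewrite dot_crossl !mulr0 addr0.
Qed.

Lemma Jstr_frame q a b : S6 q ->
  Jstr q (a *: X q + b *: JX q) = - b *: X q + a *: JX q.
Proof.
move=> Sq; rewrite /Jstr crossDr !crossZr -/(Jstr q (JX q)) Jstr_sqr//.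
  by rewrite scalerN scaleNr addrC.
exact: X_tangent.
Qed.

Lemma Jstr_spanXJX q : S6 q ->
  Jstr q @` [set u | u \in spanXJX X q] = [set u | u \in spanXJX X q].
Proof.
move=> Sq; apply/seteqP; split => [_ [_ /memv_spanXJX[h ->] <-]|_ /memv_spanXJX[h ->]].
  apply/memv_spanXJX; exists (\row_j if j == 0 then - h 0 1 else h 0 0).
  by rewrite Jstr_frame// /frame_map !mxE.
exists (h 0 1 *: X q + - h 0 0 *: JX q); last first.
  by rewrite Jstr_frame// opprK.
apply/memv_spanXJX; exists (\row_j if j == 0 then h 0 1 else - h 0 0).
by rewrite /frame_map !mxE.
Qed.

Lemma is_leaf_range_psi p : S6 p -> is_leaf (spanXJX X) (range (psi p)).
Proof.
move=> Sp; have [X0|X0] := eqVneq (X p) 0; last exact: is_leaf_surface.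
have -> : range (psi p) = [set p]; last exact: is_leaf_point.
apply/seteqP; split => [_ [t _ <-]|_ ->]; first exact: psi_stationary.
by exists 0 => //; exact: psi0.
Qed.

Lemma psi_foliation : J_holomorphic_foliation (spanXJX X)
  [set L | exists2 p, S6 p & L = range (psi p)].
Proof.
split.
- exact: spanXJX_tangent.
- split.
  + apply/seteqP; split => [q [_ [p Sp ->] [t _ <-]]|q Sq]; first exact: psi_S6.
    by exists (range (psi q)); [exists q|exists 0 => //; exact: psi0].
  + move=> _ _ [p Sp ->] [p' Sp' ->] [q [[t _ tq] [t' _ tq']]].
    by rewrite -(range_psi_eq Xvf XJX0 t Sp) tq -tq' range_psi_eq.
  + by move=> _ [p Sp ->]; exists (psi p 0), 0.
- by move=> _ [p Sp ->]; exact: is_leaf_range_psi.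
- exact: Jstr_spanXJX.
Qed.

Lemma psi_solves_HDW p c : S6 p -> solves_HDW (fun=> c) (psi p).
Proof.
move=> Sp; split; first exact: smooth_psi.
  by move=> t; exact: psi_S6.
move=> t w tw; have [_ ->] := psi_is_diff Xvf JXvf XJX0 t Sp.
set q := psi p t in tw *; have Sq : S6 q by exact: psi_S6.
rewrite /frame_map !mxE /= !scale1r !scale0r addr0 add0r.
rewrite /dS6 (_ : (fun=> c) \o _ = cst c)// derive_cst oppr0.
rewrite /omega_tilde cross_crossr dotC -scaleN1r dotDr !dotZr.
by rewrite [dot w q]dotC tw [dot (X q) q]dotC X_tangent// !mul0r !mulr0 addr0.
Qed.

End Foliation.

Theorem proposition4p11 (R : realType) (X : 'rV[R]_7 -> 'rV[R]_7)
    (hX : vector_field X) :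
  (lie_derivative_J_eq0 X ->
     forall p, S6 p -> lie_bracket X (Jfield X) p = 0) /\
  ((forall p, S6 p -> lie_bracket X (Jfield X) p = 0) ->
     exists F : set (set 'rV[R]_7),
       J_holomorphic_foliation (spanXJX X) F /\
       forall p, S6 p ->
         (forall c : R, solves_HDW (fun _ => c) (psi X (Jfield X) p)) /\
         (forall L, F L -> L p -> L = range (psi X (Jfield X) p))).
Proof.
split; first exact: bracket_XJX_eq0.
move=> XJX0; exists [set L | exists2 p, S6 p & L = range (psi X (Jfield X) p)].
split; first exact: psi_foliation.
move=> p Sp; split=> [c|_ [p' Sp' ->] [t _ tp]]; first exact: psi_solves_HDW.
by rewrite -tp range_psi_eq.
Qed.
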